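(* Let $n\ge 3$ and let $(I,\Gamma)$ and $(J,\Delta)$ be two form ideals of a form ring $(A,\Lambda)$. Then $$\mathrm{EU}(2n,(I,\Gamma)\circ(J,\Delta))\le[\mathrm{FU}(2n,I,\Gamma),\mathrm{FU}(2n,J,\Delta)]\le[\mathrm{EU}(2n,I,\Gamma),\mathrm{EU}(2n,J,\Delta)]$$ $$\le[\mathrm{GU}(2n,I,\Gamma),\mathrm{GU}(2n,J,\Delta)]\le\mathrm{GU}(2n,(I,\Gamma)\circ(J,\Delta)).$$
   Context: Form rings. $A$ is an associative ring with $1$ with an involution $a\mapsto\bar a$ (an additive anti-automorphism with $\bar{\bar a}=a$), and $\lambda$ is a fixed central element of $A$ with $\lambda\bar\lambda=1$. Put $\Lambda_{\min}=\{a-\lambda\bar a\mid a\in A\}$, $\Lambda_{\max}=\{a\in A\mid a=-\lambda\bar a\}$. A form parameter is an additive subgroup $\Lambda$ with $\Lambda_{\min}\le\Lambda\le\Lambda_{\max}$ and $a\Lambda\bar a\le\Lambda$ for all $a\in A$; $(A,\Lambda)$ is then a form ring. Form ideals. Let $I$ be a two-sided ideal of $A$ with $\bar I=I$. Put $\Gamma_{\max}(I)=I\cap\Lambda$ and $\Gamma_{\min}(I)=\{\xi-\lambda\bar\xi\mid\xi\in I\}+\langle\xi\alpha\bar\xi\mid\xi\in I,\alpha\in\Lambda\rangle$ ($\langle\cdot\rangle$ denotes the additive subgroup generated). A relative form parameter of level $I$ is an additive subgroup $\Gamma$ with $\Gamma_{\min}(I)\le\Gamma\le\Gamma_{\max}(I)$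 and $a\Gamma\bar a\le\Gamma$ for all $a\in A$; $(I,\Gamma)$ is then a form ideal. The symmetrised product of form ideals is $$(I,\Gamma)\circ(J,\Delta)=\big(IJ+JI,\ \Gamma_{\min}(IJ+JI)+{}^J\Gamma+{}^I\Delta\big),$$ where ${}^J\Gamma=\langle\xi\gamma\bar\xi\mid\xi\in J,\gamma\in\Gamma\rangle$ and ${}^I\Delta=\langle\xi\delta\bar\xi\mid\xi\in I,\delta\in\Delta\rangle$. Unitary groups. Index the coordinates of the free right module $V=A^{2n}$ of columns by $\Omega=\{1,\dots,n,-n,\dots,-1\}$, with $\varepsilon(i)=1$ for $i>0$ and $\varepsilon(i)=-1$ for $i<0$. Let $f(u,v)=\bar u_1v_{-1}+\dots+\bar u_nv_{-n}$, $h(u,v)=f(u,v)+\lambda\overline{f(v,u)}$ and $q(u)=f(u,u)\bmod\Lambda$. $\mathrm{GU}(2n,A,\Lambda)$ is the group of all $g\in\mathrm{GL}(2n,A)$ with $h(gu,gv)=h(u,v)$ and $q(gu)=q(u)$ for all $u,v\in V$. The principal congruence subgroup $\mathrm{GU}(2n,I,\Gamma)$ consists of all $g\in\mathrm{GU}(2n,A,\Lambda)$ that are congruent to the identity matrix modulo $I$ and satisfy $f(gu,gu)\in f(u,u)+\Gamma$ for all $u\in V$. Elementary subgroups. For $i\ne\pm j$ in $\Omega$ and $\xi\in A$ put $T_{ij}(\xi)=e+\xi e_{ij}-\lambda^{(\varepsilon(j)-\varepsilon(i))/2}\bar\xi e_{-j,-i}$; for $i\in\Omega$ and $\alpha\in\lambda^{-(\varepsilon(i)+1)/2}\Lambda$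 put $T_{i,-i}(\alpha)=e+\alpha e_{i,-i}$. $\mathrm{EU}(2n,A,\Lambda)$ is the subgroup generated by all these elements. $\mathrm{FU}(2n,I,\Gamma)$ is the subgroup generated by all $T_{ij}(\xi)$ with $i\neq\pm j$, $\xi\in I$, and all $T_{i,-i}(\alpha)$ with $\alpha\in\lambda^{-(\varepsilon(i)+1)/2}\Gamma$. $\mathrm{EU}(2n,I,\Gamma)$ is the normal closure of $\mathrm{FU}(2n,I,\Gamma)$ in $\mathrm{EU}(2n,A,\Lambda)$. For a form ideal written $(K,\Omega')=(I,\Gamma)\circ(J,\Delta)$, $\mathrm{EU}(2n,(I,\Gamma)\circ(J,\Delta))$ means $\mathrm{EU}(2n,K,\Omega')$, and similarly for $\mathrm{GU}$. For subgroups $H,K$ of a group, $[H,K]$ is the subgroup generated by all $[x,y]=xyx^{-1}y^{-1}$, $x\in H$, $y\in K$. *)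

(* Defs.v *)
(* Mathematical Components, with [set T] from mathcomp.classical for
   subsets of possibly infinite types. *)
From HB Require Import structures.
From mathcomp Require Import all_boot all_algebra.
From mathcomp Require Import classical_sets.

Set Implicit Arguments.
Unset Strict Implicit.
Unset Printing Implicit Defensive.

Import GRing.Theory.
Local Open Scope classical_set_scope.
Local Open Scope ring_scope.

Section AdditiveSubgroups.
Variable V : zmodType.

Definition additive_subgroup (S : set V) : Prop :=
  [/\ S 0, forall x y, S x -> S y -> S (x + y) & forall x, S x -> S (- x)].

Definition add_gen (X : set V) : set V := smallest additive_subgroup X.

Definition add_sets (S T : set V) : set V := [set x + y | x in S & y in T].

End AdditiveSubgroups.

Section Subgroups.
Local Open Scope group_scope.
Variable G : groupType.

Definition subgroup (H : set G) : Prop :=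
  [/\ H 1, forall x y, H x -> H y -> H (x * y) & forall x, H x -> H x^-1].

Definition subgroup_gen (X : set G) : set G := smallest subgroup X.

Definition normal_closure (H K : set G) : set G :=
  smallest (fun N => subgroup N /\
                     forall g x, K g -> N x -> N (g * x * g^-1)) H.

(* The library's [~ x, y] is x^-1 * y^-1 * x * y, hence the explicit product. *)
Definition comm_subgroup (H K : set G) : set G :=
  subgroup_gen [set x * y * x^-1 * y^-1 | x in H & y in K].

End Subgroups.

(* GL(m, R) for a noncommutative ring R: a matrix paired with its two-sided
   inverse. *)
Section GeneralLinear.
Variables (R : pzRingType) (m : nat).

Definition GL_pred (p : 'M[R]_m * 'M[R]_m) : bool :=
  (p.1 *m p.2 == 1%:M) && (p.2 *m p.1 == 1%:M).

Record GL : Type := MkGL { GL_pair : 'M[R]_m * 'M[R]_m; _ : GL_pred GL_pair }.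

HB.instance Definition _ := [isSub for GL_pair].
HB.instance Definition _ := [Choice of GL by <:].

Definition GLmx (g : GL) : 'M[R]_m := (GL_pair g).1.

Lemma GL_mulV (g : GL) : GLmx g *m (GL_pair g).2 = 1%:M.
Proof. by case: g => -[a b] h; case/andP: (h) => /eqP. Qed.

Lemma GL_Vmul (g : GL) : (GL_pair g).2 *m GLmx g = 1%:M.
Proof. by case: g => -[a b] h; case/andP: (h) => _ /eqP. Qed.

Lemma GLmx_inj : injective GLmx.
Proof.
move=> g h e; apply: val_inj; rewrite /= [LHS]surjective_pairing.
rewrite [RHS]surjective_pairing; congr (_, _); first exact: e.
rewrite -[LHS]mulmx1 -(GL_mulV h) -e mulmxA GL_Vmul.
by rewrite mul1mx.
Qed.

Lemma GL_one_subproof : GL_pred (1%:M, 1%:M).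
Proof. by rewrite /GL_pred /= mulmx1 eqxx. Qed.
Definition GL_one : GL := MkGL GL_one_subproof.

Lemma GL_inv_subproof (g : GL) : GL_pred ((GL_pair g).2, (GL_pair g).1).
Proof. by case: g => p /=; rewrite /GL_pred andbC. Qed.
Definition GL_inv (g : GL) : GL := MkGL (GL_inv_subproof g).

Lemma GL_mul_subproof (g h : GL) :
  GL_pred (GLmx g *m GLmx h, (GL_pair h).2 *m (GL_pair g).2).
Proof.
rewrite /GL_pred /= mulmxA -(mulmxA (GLmx g)) GL_mulV mulmx1 GL_mulV eqxx /=.
by rewrite mulmxA -(mulmxA (GL_pair h).2) GL_Vmul mulmx1 GL_Vmul.
Qed.
Definition GL_mul (g h : GL) : GL := MkGL (GL_mul_subproof g h).

Lemma GL_mulA : associative GL_mul.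
Proof. by move=> g h k; apply: GLmx_inj; rewrite /GLmx /= mulmxA. Qed.
Lemma GL_mul1 : left_id GL_one GL_mul.
Proof. by move=> g; apply: GLmx_inj; rewrite /GLmx /= mul1mx. Qed.
Lemma GL_mulr1 : right_id GL_one GL_mul.
Proof. by move=> g; apply: GLmx_inj; rewrite /GLmx /= mulmx1. Qed.
Lemma GL_mulVg : left_inverse GL_one GL_inv GL_mul.
Proof. by move=> g; apply: GLmx_inj; exact: GL_Vmul. Qed.
Lemma GL_mulgV : right_inverse GL_one GL_inv GL_mul.
Proof. by move=> g; apply: GLmx_inj; exact: GL_mulV. Qed.

HB.instance Definition _ :=
  isGroup.Build GL GL_mulA GL_mul1 GL_mulr1 GL_mulVg GL_mulgV.

End GeneralLinear.

Record formRing : Type := FormRing {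
  form_carrier :> pzRingType;
  bar : form_carrier -> form_carrier;
  barD : forall a b, bar (a + b) = bar a + bar b;
  barM : forall a b, bar (a * b) = bar b * bar a;
  barK : forall a, bar (bar a) = a;
  lam : form_carrier;
  lam_central : forall a, lam * a = a * lam;
  lam_bar : lam * bar lam = 1;
  Lam : set form_carrier;
  Lam_additive : additive_subgroup Lam;
  Lam_min : forall a, Lam (a - lam * bar a);
  Lam_max : forall a, Lam a -> a = - (lam * bar a);
  Lam_stable : forall a x, Lam x -> Lam (a * x * bar a) }.

Arguments bar {f} a.
Arguments lam {f}.
Arguments Lam {f}.

Section FormIdeals.
Variable A : formRing.
Implicit Types I J Gam Del : set A.

Definition two_sided_ideal I : Prop :=
  additive_subgroup I /\ forall a x, I x -> I (a * x) /\ I (x * a).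

(* sandwich I G is the additive subgroup generated by all x g bar(x), with
   x in I and g in G. *)
Definition sandwich I Gam : set A :=
  add_gen [set x * g * bar x | x in I & g in Gam].

Definition Gam_max I : set A := I `&` Lam.

Definition Gam_min I : set A :=
  add_sets [set x - lam * bar x | x in I] (sandwich I Lam).

Definition form_ideal I Gam : Prop :=
  [/\ two_sided_ideal I,
      [set bar x | x in I] = I,
      additive_subgroup Gam,
      Gam_min I `<=` Gam /\ Gam `<=` Gam_max I
    & forall a g, Gam g -> Gam (a * g * bar a)].

Definition ideal_prod I J : set A := add_gen [set x * y | x in I & y in J].

(* The two components of the symmetrised product (I,Gam) o (J,Del). *)
Definition symm_ideal I J : set A :=
  add_sets (ideal_prod I J) (ideal_prod J I).

Definition symm_param I Gam J Del : set A :=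
  add_sets (add_sets (Gam_min (symm_ideal I J)) (sandwich J Gam))
           (sandwich I Del).

End FormIdeals.

Section UnitaryGroups.
Variables (A : formRing) (n : nat).
Implicit Types (I Gam : set A) (i j : 'I_(2 * n)) (u v : 'cV[A]_(2 * n)).

(* The coordinates 1, ..., n, -n, ..., -1 are numbered 0, ..., 2n-1 in this
   order, so that the sign change i |-> -i is [rev_ord] and i is positive when
   its number is smaller than n. *)
Definition eps i : int := if (i < n)%N then 1 else - 1.

Definition form_f u v : A :=
  \sum_(i < 2 * n | (i < n)%N) bar (u i ord0) * v (rev_ord i) ord0.

Definition form_h u v : A := form_f u v + lam * bar (form_f v u).

(* q(u) = q(v), where q(u) is the class of f(u,u) modulo Lambda *)
Definition same_q u v : Prop := Lam (form_f u u - form_f v v).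

Definition GU : set (GL A (2 * n)) :=
  [set g | (forall u v, form_h (GLmx g *m u) (GLmx g *m v) = form_h u v) /\
           (forall u, same_q (GLmx g *m u) u)].

Definition GU_rel I Gam : set (GL A (2 * n)) :=
  [set g | [/\ GU g,
               forall i j, I (GLmx g i j - (1%:M : 'M[A]_(2 * n)) i j)
             & forall u, Gam (form_f (GLmx g *m u) (GLmx g *m u)
                              - form_f u u)]].

(* lam ^ z for an integer z; the inverse of lam is bar lam. *)
Definition lam_pow (z : int) : A :=
  match z with
  | Posz k => lam ^+ k
  | Negz k => bar lam ^+ k.+1
  end.

Definition T_short i j (x : A) : 'M[A]_(2 * n) :=
  1%:M + x *: delta_mx i j
  - (lam_pow ((eps j - eps i) %/ 2)%Z * bar x) *: delta_mx (rev_ord j) (rev_ord i).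

Definition T_long i (a : A) : 'M[A]_(2 * n) :=
  1%:M + a *: delta_mx i (rev_ord i).

Definition lam_twist i Gam : set A :=
  [set lam_pow (- ((eps i + 1) %/ 2)%Z) * a | a in Gam].

Definition elementary I Gam : set (GL A (2 * n)) :=
  [set g | (exists i j x, [/\ i != j, i != rev_ord j, I x
                            & GLmx g = T_short i j x])
        \/ (exists i a, lam_twist i Gam a /\ GLmx g = T_long i a)].

Definition FU I Gam : set (GL A (2 * n)) := subgroup_gen (elementary I Gam).

Definition EU : set (GL A (2 * n)) := subgroup_gen (elementary [set: A] Lam).

Definition EU_rel I Gam : set (GL A (2 * n)) :=
  normal_closure (FU I Gam) EU.

End UnitaryGroups.

Arguments lam_pow {A} z.
Arguments GU {A} n.
Arguments GU_rel {A} n I Gam.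
Arguments elementary {A} n I Gam.
Arguments FU {A} n I Gam.
Arguments EU {A} n.
Arguments EU_rel {A} n I Gam.

Section Invertibility.
Variables (A : formRing) (n : nat).

Lemma rev_ord_neq (i : 'I_(2 * n)) : i != rev_ord i.
Proof.
apply/eqP=> /(congr1 val) /= e.
have /(congr1 odd) : (i + i.+1 = 2 * n)%N by rewrite {1}e subnK.
by rewrite addnS addnn /= oddM /= odd_double.
Qed.

Lemma bar0 : bar (0 : A) = 0.
Proof. by apply: (addrI (bar (0 : A))); rewrite -barD !addr0. Qed.

Lemma barN (x : A) : bar (- x) = - bar x.
Proof. by apply: (addrI (bar x)); rewrite -barD !subrr bar0. Qed.

Lemma mx_unipotent (m : nat) (N : 'M[A]_m) :
  N *m N = 0 -> GL_pred (1%:M + N, 1%:M - N).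
Proof.
move=> N0; rewrite /GL_pred /= !(mulmxDl, mulmxDr, mulmxN, mulNmx).
by rewrite !mul1mx !mulmx1 N0 oppr0 !addr0 addrNK addrK eqxx.
Qed.

(* Every elementary matrix is the matrix of an element of GL(2n, A). *)
Lemma T_long_GL (i : 'I_(2 * n)) (a : A) : exists g, GLmx g = T_long i a.
Proof.
have N0 : (a *: delta_mx i (rev_ord i)) *m
          (a *: delta_mx i (rev_ord i)) = 0 :> 'M[A]_(2 * n).
  apply/matrixP=> k l; rewrite !mxE big1 // => s _; rewrite !mxE.
  case: (s =P i) => [->|_]; last by rewrite !(mulr0, andbF).
  by rewrite (negPf (rev_ord_neq i)) andbF mulr0 mul0r.
by exists (MkGL (mx_unipotent N0)).
Qed.

Lemma T_short_GL (i j : 'I_(2 * n)) (x : A) :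
  i != j -> i != rev_ord j -> exists g, GLmx g = T_short i j x.
Proof.
move=> ij irj; set y := lam_pow ((eps j - eps i) %/ 2)%Z * bar x.
pose N : 'M[A]_(2 * n) :=
  x *: delta_mx i j - y *: delta_mx (rev_ord j) (rev_ord i).
have N0 : N *m N = 0.
  have rij : rev_ord i != j.
    by apply: contra irj => /eqP <-; rewrite rev_ordK.
  have rirj : rev_ord i != rev_ord j by rewrite (inj_eq rev_ord_inj).
  apply/matrixP=> k l; rewrite !mxE big1 // => s _; rewrite !mxE.
  case: (s =P j) => [->|_].
    rewrite (eq_sym j i) (negPf ij) (negPf (rev_ord_neq j)) /=.
    by rewrite !mulr0 subr0 mulr0.
  case: (s =P rev_ord i) => [->|_].
    rewrite (negPf rirj) (eq_sym (rev_ord i) i) (negPf (rev_ord_neq i)) /=.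
    by rewrite !mulr0 subr0 mulr0.
  by rewrite !andbF !mulr0 subr0 mul0r.
exists (MkGL (mx_unipotent N0)).
by rewrite /GLmx /= /T_short addrA.
Qed.

End Invertibility.

(* Main.v *)
(* Write phi_g(u) = f(gu, gu) - f(u, u).  If g preserves h, then
   phi_g(u + v) = phi_g(u) + phi_g(v) + (x - lam bar(x)) with
   x = f(gv, gu) - f(v, u); hence the congruence subgroups are normal in GU, and
   [GU(I, Gam), GU(J, Del)] has level (I, Gam) o (J, Del).

   Every elementary generator is an Eichler transformation esd h v c attached to
   the isotropic vector e_h.  For g in the stabiliser L_h of e_h and e_{-h},
   g (esd h v c) g^-1 = esd h (gv) (c + phi_g(v)), and this takes the place of
   the Chevalley commutator formulas.  Since n >= 3, every elementary generator t
   of level (K, Om) = (I, Gam) o (J, Del) avoids the indices +-p for some p, and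
   routing the commutator formula for t through the index p exhibits t as a
   product of commutators of elements of FU(I, Gam) and FU(J, Del) lying in the
   unipotent radicals at p and -p.  As L_p normalises these radicals, all
   conjugates g t g^-1 with g in L_p lie in [FU(I, Gam), FU(J, Del)].  Finally,
   the subgroup generated by these conjugates is normalised by EU: a generator of
   EU either lies in L_p or in the radical at p or -p, and in the latter case it
   commutes with g t g^-1 up to an element of level (K, Om) of that radical. *)
Require Import Defs.
From mathcomp Require Import all_boot all_algebra.
From mathcomp Require Import classical_sets.
From Stdlib Require Ncring Ncring_tac.

Set Implicit Arguments.
Unset Strict Implicit.
Unset Printing Implicit Defensive.

Import GRing.Theory.
Local Open Scope classical_set_scope.

(** * Generated additive subgroups, their sums and preimages *)

Section AdditiveSubgroupTheory.
Local Open Scope ring_scope.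
Variable V : zmodType.
Implicit Types (S T X : set V) (x y : V).

Lemma addsubB S x y : additive_subgroup S -> S x -> S y -> S (x - y).
Proof. by case=> _ SD SN Sx Sy; apply: SD => //; apply: SN. Qed.

Lemma addsub_sum S (I : Type) (r : seq I) (P : pred I) (F : I -> V) :
  additive_subgroup S -> (forall i, P i -> S (F i)) ->
  S (\sum_(i <- r | P i) F i).
Proof. by case=> S0 SD _ SF; apply: big_ind. Qed.

Lemma add_gen_subgroup X : additive_subgroup (add_gen X).
Proof.
split; first by move=> S [[]].
  move=> x y Xx Xy S SX; case: (SX) => [[_ SD _] _].
  exact: SD (Xx _ SX) (Xy _ SX).
by move=> x Xx S SX; case: (SX) => [[_ _ SN] _]; exact: SN (Xx _ SX).
Qed.

Lemma add_sets_subgroup S T :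
  additive_subgroup S -> additive_subgroup T -> additive_subgroup (add_sets S T).
Proof.
move=> [S0 SD SN] [T0 TD TN]; split.
- by exists 0 => //; exists 0 => //; rewrite addr0.
- move=> _ _ [x Sx [y Ty <-]] [x' Sx' [y' Ty' <-]].
  by exists (x + x'); [exact: SD | exists (y + y'); [exact: TD | rewrite addrACA]].
- move=> _ [x Sx [y Ty <-]].
  by exists (- x); [exact: SN | exists (- y); [exact: TN | rewrite opprD]].
Qed.

Lemma add_setsl S T : additive_subgroup T -> S `<=` add_sets S T.
Proof. by case=> T0 _ _ x Sx; exists x => //; exists 0; rewrite ?addr0. Qed.

Lemma add_setsr S T : additive_subgroup S -> T `<=` add_sets S T.
Proof. by case=> S0 _ _ x Tx; exists 0 => //; exists x; rewrite ?add0r. Qed.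

Lemma add_sets_min S T X :
  additive_subgroup X -> S `<=` X -> T `<=` X -> add_sets S T `<=` X.
Proof. by move=> [_ XD _] SX TX _ [x Sx [y Ty <-]]; apply: XD; auto. Qed.

Lemma addsub_preim (W : zmodType) (f : W -> V) S :
  {morph f : x y / x + y} -> additive_subgroup S -> additive_subgroup (f @^-1` S).
Proof.
move=> fD [S0 SD SN].
have f0 : f (0 : W) = 0 by apply: (addrI (f 0)); rewrite -fD !addr0.
have fN (x : W) : f (- x) = - f x.
  by apply: (addrI (f x)); rewrite -fD !subrr f0.
split=> [|x y Sx Sy|x Sx]; rewrite /preimage /= ?f0 //.
  by rewrite fD; apply: SD.
by rewrite fN; apply: SN.
Qed.

End AdditiveSubgroupTheory.

(** * Generated subgroups, commutator subgroups and normal closures *)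

Section SubgroupTheory.
Local Open Scope group_scope.
Variable G : groupType.
Implicit Types (H K N X : set G) (g x y : G).

Lemma subgroup_gen_subgroup X : subgroup (subgroup_gen X).
Proof.
split; first by move=> S [[]].
  move=> x y Xx Xy S SX; case: (SX) => [[_ SD _] _].
  exact: SD (Xx _ SX) (Xy _ SX).
by move=> x Xx S SX; case: (SX) => [[_ _ SN] _]; exact: SN (Xx _ SX).
Qed.

Lemma mem_comm_subgroup H K x y :
  H x -> K y -> comm_subgroup H K (x * y * x^-1 * y^-1).
Proof. by move=> Hx Ky; apply: sub_gen_smallest; exists x => //; exists y. Qed.

Lemma comm_subgroup_mono H K H' K' :
  H `<=` H' -> K `<=` K' -> comm_subgroup H K `<=` comm_subgroup H' K'.
Proof.
move=> HH' KK'; apply: smallest_sub (subgroup_gen_subgroup _) _.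
by move=> _ [x Hx [y Ky <-]]; apply: mem_comm_subgroup; auto.
Qed.

Lemma comm_subgroup_sym H K : comm_subgroup H K `<=` comm_subgroup K H.
Proof.
apply: smallest_sub (subgroup_gen_subgroup _) _ => _ [x Hx [y Ky <-]].
have -> : x * y * x^-1 * y^-1 = (y * x * y^-1 * x^-1)^-1.
  by rewrite !invgM !invgK !mulgA.
by case: (subgroup_gen_subgroup [set x * y * x^-1 * y^-1 | x in K & y in H])
  => _ _; apply; apply: mem_comm_subgroup.
Qed.

Lemma normal_closure_sub H K : H `<=` normal_closure H K.
Proof. by move=> x Hx N [_]; apply. Qed.

Lemma subgroup_conj_preim H g :
  subgroup H -> subgroup [set x | H (g * x * g^-1)].
Proof.
move=> [H1 HM HV]; split=> [|x y Hx Hy|x Hx] /=.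
- by rewrite mulg1 mulgV.
- have -> : g * (x * y) * g^-1 = (g * x * g^-1) * (g * y * g^-1).
    by rewrite !mulgA mulgVK.
  exact: HM.
- have -> : g * x^-1 * g^-1 = (g * x * g^-1)^-1.
    by rewrite !invgM invgK !mulgA.
  exact: HV.
Qed.

(** The elements g such that both g and its inverse conjugate [N] into itself form a subgroup, so
    normality may be tested on a generating set closed under inverses. *)
Lemma normal_closure_gen_min H X N :
    subgroup N -> H `<=` N -> (forall g, X g -> X g^-1) ->
    (forall g x, X g -> N x -> N (g * x * g^-1)) ->
  normal_closure H (subgroup_gen X) `<=` N.
Proof.
move=> Nsub HN XV XN x; apply; split=> //; split=> // {x} g x Kg Nx.
pose K := [set g | forall x, N x -> N (g * x * g^-1) /\ N (g^-1 * x * g)].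
have Ksub : subgroup K.
  split=> [y Ny|a b Ka Kb y Ny|a Ka y Ny] /=.
  - by rewrite invg1 mul1g mulg1.
  - split.
      have -> : a * b * y * (a * b)^-1 = a * (b * y * b^-1) * a^-1.
        by rewrite invgM !mulgA.
      by apply: (Ka _ _).1; apply: (Kb _ _).1.
    have -> : (a * b)^-1 * y * (a * b) = b^-1 * (a^-1 * y * a) * b.
      by rewrite invgM !mulgA.
    by apply: (Kb _ _).2; apply: (Ka _ _).2.
  - by rewrite invgK; split; [exact: (Ka _ _).2 | exact: (Ka _ _).1].
have /(_ _ Kg) /(_ _ Nx) [//] : subgroup_gen X `<=` K.
apply: smallest_sub => // a Xa y Ny; split; first exact: XN.
by rewrite -{2}(invgK a); apply: XN => //; apply: XV.
Qed.

End SubgroupTheory.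

(** * Automation for identities in a noncommutative ring *)

Ltac ncring := Ncring_tac.non_commutative_ring.

(** In goals for [ncring], terms such as [bar x] and [lam] are atoms: [bar] has to be distributed,
    and the centrality of [lam] applied, beforehand. *)
#[local] Instance formRing_Ring_ops (A : formRing) :
  @Ncring.Ring_ops (form_carrier A) 0%R 1%R +%R *%R (fun x y => x - y)%R
    (@GRing.opp A) eq := {}.

#[local] Instance formRing_Ring (A : formRing) :
  @Ncring.Ring A _ _ _ _ _ _ _ (formRing_Ring_ops A).
Proof.
split; try exact: RelationClasses.eq_equivalence.
- by move=> x y e u v f; red in e, f |- *; rewrite e f.
- by move=> x y e u v f; red in e, f |- *; rewrite e f.
- by move=> x y e u v f; red in e, f |- *; rewrite e f.
- by move=> x y e; red in e |- *; rewrite e.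
- by move=> x; apply: add0r.
- by move=> x y; apply: addrC.
- by move=> x y z; apply: addrA.
- by move=> x; apply: mul1r.
- by move=> x; apply: mulr1.
- by move=> x y z; apply: mulrA.
- by move=> x y z; apply: mulrDl.
- by move=> x y z; apply: mulrDr.
- by [].
- by move=> x; apply: subrr.
Qed.

(** * Form ideals and their symmetrised product *)

Section FormRingTheory.
Local Open Scope ring_scope.
Variable A : formRing.
Implicit Types (I J Gam Del S : set A) (a b x y : A).

Lemma barB a b : bar (a - b) = bar a - bar b.
Proof. by rewrite barD barN. Qed.

Lemma bar1 : bar (1 : A) = 1.
Proof. by rewrite -[LHS]mulr1 -[X in _ * X = _]barK -barM mulr1 barK. Qed.

Lemma bar_lam_lam : bar lam * lam = 1 :> A.
Proof. by rewrite -lam_central lam_bar. Qed.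

Lemma bar_lam_central a : bar lam * a = a * bar lam.
Proof. by rewrite -[a in LHS]barK -barM -lam_central barM barK. Qed.

Lemma Lam_bar a : Lam a -> lam * bar a = - a.
Proof. by move/Lam_max=> {2}->; rewrite opprK. Qed.

Lemma Lam_barE a : Lam a -> bar a = - (bar lam * a).
Proof.
by move/Lam_bar=> e; rewrite -mulrN -e mulrA bar_lam_lam mul1r.
Qed.

Section FormIdealTheory.
Variables I Gam : set A.
Hypothesis hI : form_ideal I Gam.

Lemma level_subgroup : additive_subgroup I.
Proof. by case: hI => [[]]. Qed.

Lemma level_mull a x : I x -> I (a * x).
Proof. by case: hI => [[_ Im]] _ _ _ _ /(Im a) []. Qed.

Lemma level_mulr a x : I x -> I (x * a).
Proof. by case: hI => [[_ Im]] _ _ _ _ /(Im a) []. Qed.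

Lemma level_bar x : I x -> I (bar x).
Proof. by case: hI => _ Ibar _ _ _ Ix; rewrite -Ibar; exists x. Qed.

Lemma param_subgroup : additive_subgroup Gam.
Proof. by case: hI. Qed.

Lemma param_skew x : I x -> Gam (x - lam * bar x).
Proof.
case: hI => _ _ _ [Gm _] _ Ix; apply: Gm; apply: add_setsl; last by exists x.
exact: add_gen_subgroup.
Qed.

Lemma param_sandwich a x : I x -> Lam a -> Gam (x * a * bar x).
Proof.
have [I0 _ _] := level_subgroup.
case: hI => _ _ _ [Gm _] _ Ix La; apply: Gm; exists 0.
  by exists 0 => //; rewrite bar0 mulr0 subrr.
exists (x * a * bar x); last by rewrite add0r.
by apply: sub_gen_smallest; exists x => //; exists a.
Qed.

Lemma param_level x : Gam x -> I x.
Proof. by case: hI => _ _ _ [_ Gm] _ /Gm []. Qed.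

Lemma param_Lam x : Gam x -> Lam x.
Proof. by case: hI => _ _ _ [_ Gm] _ /Gm []. Qed.

Lemma param_stable a x : Gam x -> Gam (a * x * bar a).
Proof. by case: hI => _ _ _ _; apply. Qed.

Lemma param_stable_bar a x : Gam x -> Gam (bar a * x * a).
Proof. by move=> Gx; rewrite -[a in _ * a]barK; apply: param_stable. Qed.

End FormIdealTheory.

Lemma form_ideal_setT : form_ideal [set: A] Lam.
Proof.
split; first by split.
- by apply/seteqP; split=> // x _; exists (bar x); rewrite ?barK.
- exact: Lam_additive.
- split; last by move=> x.
  apply: add_sets_min; first exact: Lam_additive.
    by move=> _ [x _ <-]; apply: Lam_min.
  apply: smallest_sub; first exact: Lam_additive.
  by move=> _ [x _ [y Ly <-]]; apply: Lam_stable.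
- by move=> a x; apply: Lam_stable.
Qed.

Section SymmetrisedProduct.
Variables I Gam J Del : set A.
Hypotheses (hI : form_ideal I Gam) (hJ : form_ideal J Del).
Let K := symm_ideal I J.
Let Om := symm_param I Gam J Del.

Lemma symm_ideal_subgroup : additive_subgroup K.
Proof. by apply: add_sets_subgroup; exact: add_gen_subgroup. Qed.

Lemma symm_ideall x y : I x -> J y -> K (x * y).
Proof.
move=> Ix Jy; apply: add_setsl; first exact: add_gen_subgroup.
by apply: sub_gen_smallest; exists x => //; exists y.
Qed.

Lemma symm_idealr x y : I x -> J y -> K (y * x).
Proof.
move=> Ix Jy; apply: add_setsr; first exact: add_gen_subgroup.
by apply: sub_gen_smallest; exists y => //; exists x.
Qed.

(** Elimination principle for IJ + JI, mostly applied with [S] the preimage of a subgroup under an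
    additive map. *)
Lemma symm_ideal_min S : additive_subgroup S ->
  (forall x y, I x -> J y -> S (x * y)) ->
  (forall x y, I x -> J y -> S (y * x)) -> K `<=` S.
Proof.
move=> Ssub Sl Sr; apply: add_sets_min => //; apply: smallest_sub => //.
  by move=> _ [x Ix [y Jy <-]]; apply: Sl.
by move=> _ [y Jy [x Ix <-]]; apply: Sr.
Qed.

Lemma symm_ideal_mull a x : K x -> K (a * x).
Proof.
suff: K `<=` ( *%R a) @^-1` K by apply.
apply: symm_ideal_min => [|y z Iy Jz|y z Iy Jz]; rewrite /preimage /= ?mulrA.
- by apply: addsub_preim symm_ideal_subgroup; exact: mulrDr.
- by apply: symm_ideall => //; apply: (level_mull hI).
- by apply: symm_idealr => //; apply: (level_mull hJ).
Qed.

Lemma symm_ideal_mulr a x : K x -> K (x * a).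
Proof.
suff: K `<=` (fun x => x * a) @^-1` K by apply.
apply: symm_ideal_min => [|y z Iy Jz|y z Iy Jz]; rewrite /preimage /= -?mulrA.
- by apply: addsub_preim symm_ideal_subgroup => u v; exact: mulrDl.
- by apply: symm_ideall => //; apply: (level_mulr hJ).
- by apply: symm_idealr => //; apply: (level_mulr hI).
Qed.

Lemma symm_ideal_bar x : K x -> K (bar x).
Proof.
suff: K `<=` (@bar A) @^-1` K by apply.
apply: symm_ideal_min => [|y z Iy Jz|y z Iy Jz]; rewrite /preimage /= ?barM.
- by apply: addsub_preim symm_ideal_subgroup; exact: barD.
- by apply: symm_idealr; [exact: (level_bar hI) | exact: (level_bar hJ)].
- by apply: symm_ideall; [exact: (level_bar hI) | exact: (level_bar hJ)].
Qed.

Lemma symm_skew_subgroup : additive_subgroup [set x - lam * bar x | x in K].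
Proof.
have [K0 KD KN] := symm_ideal_subgroup.
split.
- by exists 0 => //; rewrite bar0 mulr0 subrr.
- move=> _ _ [x Kx <-] [y Ky <-]; exists (x + y); first exact: KD.
  by rewrite barD mulrDr opprD addrACA.
- move=> _ [x Kx <-]; exists (- x); first exact: KN.
  by rewrite barN mulrN opprB opprK addrC.
Qed.

Lemma Gam_min_subgroup : additive_subgroup (Gam_min K).
Proof. exact: add_sets_subgroup symm_skew_subgroup (add_gen_subgroup _). Qed.

Let Om1_subgroup : additive_subgroup (add_sets (Gam_min K) (sandwich J Gam)).
Proof. exact: add_sets_subgroup Gam_min_subgroup (add_gen_subgroup _). Qed.

Lemma symm_param_subgroup : additive_subgroup Om.
Proof. exact: add_sets_subgroup Om1_subgroup (add_gen_subgroup _). Qed.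

Lemma Gam_min_symm_param : Gam_min K `<=` Om.
Proof.
by move=> x Gx; do 2 (apply: add_setsl; first exact: add_gen_subgroup).
Qed.

Lemma symm_param_skew x : K x -> Om (x - lam * bar x).
Proof.
move=> Kx; apply: Gam_min_symm_param; apply: add_setsl; last by exists x.
exact: add_gen_subgroup.
Qed.

Lemma symm_param_l x g : J x -> Gam g -> Om (x * g * bar x).
Proof.
move=> Jx Gg; apply: add_setsl; first exact: add_gen_subgroup.
apply: add_setsr; first exact: Gam_min_subgroup.
by apply: sub_gen_smallest; exists x => //; exists g.
Qed.

Lemma symm_param_r x g : I x -> Del g -> Om (x * g * bar x).
Proof.
move=> Ix Dg; apply: add_setsr => //.
by apply: sub_gen_smallest; exists x => //; exists g.
Qed.

(* The generators x a bar(x) with x in IJ + JI and a in Lam are redundant: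
   (y z) a bar(y z) = y (z a bar(z)) bar(y), and the cross terms of a sum are
   of the form x - lam bar(x). *)
Lemma symm_param_min S : additive_subgroup S ->
  (forall x, K x -> S (x - lam * bar x)) ->
  (forall x g, J x -> Gam g -> S (x * g * bar x)) ->
  (forall x g, I x -> Del g -> S (x * g * bar x)) ->
  Om `<=` S.
Proof.
move=> Ssub Sskew Sl Sr; have [S0 SD SN] := Ssub.
have [K0 KD KN] := symm_ideal_subgroup.
apply: add_sets_min => //; last first.
  by apply: smallest_sub => // _ [x Ix [g Dg <-]]; apply: Sr.
apply: add_sets_min => //; last first.
  by apply: smallest_sub => // _ [x Ix [g Dg <-]]; apply: Sl.
apply: add_sets_min => //; first by move=> _ [x Kx <-]; apply: Sskew.
apply: smallest_sub => // _ [x Kx [a La <-]].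
suff: K `<=` [set x | K x /\ S (x * a * bar x)] by move=> /(_ _ Kx) [].
have KsubI := symm_ideal_subgroup.
apply: symm_ideal_min => [|y z Iy Jz|y z Iy Jz] /=.
- split=> [|y z [Ky Sy] [Kz Sz]|y [Ky Sy]].
  + by split=> //; rewrite !mul0r.
  + split; first exact: KD.
    have -> : (y + z) * a * bar (y + z) = y * a * bar y + z * a * bar z
      + (y * a * bar z - lam * bar (y * a * bar z)).
      (* Since lam bar(a) = -a, the second cross term z a bar(y) is -lam times the bar of the
         first. *)
      have -> : lam * bar (y * a * bar z) = - (z * a * bar y).
        by rewrite !barM barK (Lam_barE La) !(mulrN, mulNr) !mulrA lam_central
          -(mulrA z) lam_bar mulr1.
      by rewrite barD; ncring.
    apply: (SD); first exact: SD.
    by apply: Sskew; do 2 apply: symm_ideal_mulr.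
  + split; first exact: KN.
    by rewrite barN mulrN !mulNr opprK.
- split; first exact: symm_ideall.
  have -> : y * z * a * bar (y * z) = y * (z * a * bar z) * bar y.
    by rewrite barM !mulrA.
  by apply: Sr => //; apply: (param_sandwich hJ).
- split; first exact: symm_idealr.
  have -> : z * y * a * bar (z * y) = z * (y * a * bar y) * bar z.
    by rewrite barM !mulrA.
  by apply: Sl => //; apply: (param_sandwich hI).
Qed.

(** The upper bound on [Om] and its stability are additive conditions, so [symm_param_min] reduces
    them to three kinds of generators. *)
Lemma symm_form_ideal : form_ideal K Om.
Proof.
have Ksub := symm_ideal_subgroup; have Osub := symm_param_subgroup.
split=> //.
- split=> // a x Kx; split; [exact: symm_ideal_mull | exact: symm_ideal_mulr].
- apply/seteqP; split=> [_ [x Kx <-]|x Kx]; first exact: symm_ideal_bar.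
  by exists (bar x); rewrite ?barK //; exact: symm_ideal_bar.
- split; first exact: Gam_min_symm_param.
  have Lsub := Lam_additive A.
  apply: symm_param_min.
  + case: Ksub Lsub => K0 KD KN [L0 LD LN].
    split=> [|x y [Kx Lx] [Ky Ly]|x [Kx Lx]]; split=> //.
    * exact: KD.
    * exact: LD.
    * exact: KN.
    * exact: LN.
  + move=> x Kx; split; last exact: Lam_min.
    by apply: addsubB => //; apply: symm_ideal_mull; apply: symm_ideal_bar.
  + move=> x g Jx Gg; split; last exact/Lam_stable/(param_Lam hI).
    by apply/symm_ideal_mulr/symm_idealr => //; apply: (param_level hI).
  + move=> x g Ix Dg; split; last exact/Lam_stable/(param_Lam hJ).
    by apply/symm_ideal_mulr/symm_ideall => //; apply: (param_level hJ).
- move=> a x Ox; suff: Om `<=` (fun x => a * x * bar a) @^-1` Om by apply.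
  apply: symm_param_min; rewrite /preimage /=.
  + by apply: addsub_preim Osub => y z; rewrite mulrDr mulrDl.
  + move=> y Ky.
    have -> : a * (y - lam * bar y) * bar a
            = a * y * bar a - lam * bar (a * y * bar a).
      by rewrite !barM barK !mulrA (lam_central a) mulrBr mulrBl !mulrA.
    by apply: symm_param_skew; apply: symm_ideal_mulr; apply: symm_ideal_mull.
  + move=> y g Jy Gg.
    have -> : a * (y * g * bar y) * bar a = (a * y) * g * bar (a * y).
      by rewrite barM !mulrA.
    by apply: symm_param_l => //; apply: (level_mull hJ).
  + move=> y g Iy Dg.
    have -> : a * (y * g * bar y) * bar a = (a * y) * g * bar (a * y).
      by rewrite barM !mulrA.
    by apply: symm_param_r => //; apply: (level_mull hI).
Qed.

End SymmetrisedProduct.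

End FormRingTheory.

(** * Sesquilinear forms and unitary groups *)

Section UnitaryForms.
Local Open Scope ring_scope.
Variables (A : formRing) (n : nat).
Local Notation V := 'cV[A]_(2 * n).
Implicit Types (I J Gam Del S : set A) (a b x y : A) (u v w : V).
Implicit Types (h i j k : 'I_(2 * n)) (M : 'M[A]_(2 * n)).

(** Columns form a right module, whereas the scaling of matrices multiplies on the left; the right
    action is the one that commutes with matrices. *)
Definition vscale v a : V := \col_i (v i ord0 * a).

Definition ebase k : V := delta_mx k ord0.

Lemma mulmx_vscale M v a : M *m vscale v a = vscale (M *m v) a.
Proof.
by apply/colP=> i; rewrite !mxE mulr_suml; apply: eq_bigr => j _; rewrite mxE mulrA.
Qed.

Lemma vscale0 v : vscale v 0 = 0.
Proof. by apply/colP=> i; rewrite !mxE mulr0. Qed.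

Lemma vscaleA v a b : vscale (vscale v a) b = vscale v (a * b).
Proof. by apply/colP=> i; rewrite !mxE mulrA. Qed.

Lemma ebaseE k l : ebase k l ord0 = (l == k)%:R.
Proof. by rewrite mxE eqxx andbT. Qed.

Lemma col_ebaseE v : v = \sum_k vscale (ebase k) (v k ord0).
Proof.
apply/colP=> i; rewrite summxE (bigD1 i) //= !mxE !eqxx mul1r big1 ?addr0 //.
by move=> k ki; rewrite !mxE eq_sym (negPf ki) mul0r.
Qed.

Lemma mulmx_ext M M' : (forall v, M *m v = M' *m v) -> M = M'.
Proof.
by move=> e; apply/matrixP=> i j; rewrite -[M]mulmx1 -[M']mulmx1;
  have := congr1 (fun u : V => u i ord0) (e (ebase j));
  rewrite -!colE !mulmx1 !mxE.
Qed.

Lemma rev_ord_lt k : (rev_ord k < n)%N = ~~ (k < n)%N.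
Proof. 
rewrite /= -leqNgt; have := ltn_ord k; case: k => k /= kn _.
by rewrite -(ltn_add2r k.+1) subnK // addnS ltnS mul2n -addnn leq_add2l.
Qed.

Lemma form_fDl u v w : form_f (u + v) w = form_f u w + form_f v w.
Proof.
by rewrite /form_f -big_split /=; apply: eq_bigr => k _; rewrite mxE barD mulrDl.
Qed.

Lemma form_fDr u v w : form_f w (u + v) = form_f w u + form_f w v.
Proof.
by rewrite /form_f -big_split /=; apply: eq_bigr => k _; rewrite mxE mulrDr.
Qed.

Lemma form_fZl u v a : form_f (vscale u a) v = bar a * form_f u v.
Proof.
by rewrite /form_f mulr_sumr; apply: eq_bigr => k _; rewrite mxE barM mulrA.
Qed.

Lemma form_fZr u v a : form_f u (vscale v a) = form_f u v * a.
Proof.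
by rewrite /form_f mulr_suml; apply: eq_bigr => k _; rewrite mxE mulrA.
Qed.

Lemma form_f0l u : form_f 0 u = 0.
Proof. by rewrite -[0](vscale0 0) form_fZl bar0 mul0r. Qed.

Lemma form_f0r u : form_f u 0 = 0.
Proof. by rewrite -[0 in LHS](vscale0 0) form_fZr mulr0. Qed.

Lemma form_fNl u v : form_f (- u) v = - form_f u v.
Proof. by apply: (addrI (form_f u v)); rewrite -form_fDl !subrr form_f0l. Qed.

Lemma form_fNr u v : form_f u (- v) = - form_f u v.
Proof. by apply: (addrI (form_f u v)); rewrite -form_fDr !subrr form_f0r. Qed.

Lemma form_f_ebasel k v :
  form_f (ebase k) v = if (k < n)%N then v (rev_ord k) ord0 else 0.
Proof.
rewrite /form_f; case: ifP => kn; last first.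
  rewrite big1 // => i iN; rewrite ebaseE; case: eqP iN => [->|_ _].
    by rewrite kn.
  by rewrite bar0 mul0r.
rewrite (bigD1 k) //= ebaseE eqxx bar1 mul1r big1 ?addr0 // => i /andP[_ ik].
by rewrite ebaseE (negPf ik) bar0 mul0r.
Qed.

Lemma form_f_ebaser k v :
  form_f v (ebase k) = if (k < n)%N then 0 else bar (v (rev_ord k) ord0).
Proof.
rewrite /form_f; case: ifP => kn.
  rewrite big1 // => i iN; rewrite ebaseE; case: eqP => [e|_]; last by rewrite mulr0.
  by move: kn; rewrite -e rev_ord_lt iN.
rewrite (bigD1 (rev_ord k)) /=; last by rewrite rev_ord_lt kn.
rewrite ebaseE rev_ordK eqxx mulr1 big1 ?addr0 // => i /andP[_ ik].
by rewrite ebaseE -(inj_eq rev_ord_inj) rev_ordK (negPf ik) mulr0.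
Qed.

Definition form_fE := (form_fDl, form_fDr, form_fZl, form_fZr, form_fNl,
  form_fNr, form_f0l, form_f0r).

Lemma form_hDl u v w : form_h (u + v) w = form_h u w + form_h v w.
Proof. by rewrite /form_h !form_fE barD; ncring. Qed.

Lemma form_hDr u v w : form_h w (u + v) = form_h w u + form_h w v.
Proof. by rewrite /form_h !form_fE barD; ncring. Qed.

Lemma form_hZl u v a : form_h (vscale u a) v = bar a * form_h u v.
Proof. by rewrite /form_h !form_fE barM mulrDr !mulrA lam_central. Qed.

Lemma form_hZr u v a : form_h u (vscale v a) = form_h u v * a.
Proof. by rewrite /form_h !form_fE barM barK mulrDl !mulrA. Qed.

Lemma form_hNl u v : form_h (- u) v = - form_h u v.
Proof. by rewrite /form_h !form_fE barN; ncring. Qed.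

Lemma form_hNr u v : form_h u (- v) = - form_h u v.
Proof. by rewrite /form_h !form_fE barN; ncring. Qed.

Lemma form_h_bar u v : lam * bar (form_h u v) = form_h v u.
Proof.
rewrite /form_h barD barM barK -bar_lam_central mulrDr [lam * (_ * _)]mulrA.
by rewrite lam_bar mul1r addrC.
Qed.

(* The Gram matrix of h has the entries wt k at the places (k, -k). *)
Definition wt k : A := if (k < n)%N then 1 else lam.

(** The inverse of [wt (rev_ord h)], by [wt_cw]; it is also the power of lam that twists the long
    root elements, by [lam_pow_twist]. *)
Definition cw h : A := bar (wt (rev_ord h)).

Lemma wt_central k a : wt k * a = a * wt k.
Proof. by rewrite /wt; case: ifP; rewrite ?mul1r ?mulr1 ?lam_central. Qed.

Lemma cw_central k a : cw k * a = a * cw k.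
Proof. by rewrite /cw /wt; case: ifP; rewrite ?bar1 ?mul1r ?mulr1 ?bar_lam_central. Qed.

Lemma wt_rev k : wt (rev_ord k) * wt k = lam.
Proof. by rewrite /wt rev_ord_lt; case: (k < n)%N; rewrite /= ?mul1r ?mulr1. Qed.

Lemma wt_cw k : wt (rev_ord k) * cw k = 1.
Proof. by rewrite /cw /wt; case: ifP; rewrite ?bar1 ?mul1r ?lam_bar. Qed.

Lemma bar_cw k : bar (cw k) = wt (rev_ord k).
Proof. exact: barK. Qed.

Lemma form_h_ebasel k v : form_h (ebase k) v = wt k * v (rev_ord k) ord0.
Proof.
rewrite /form_h form_f_ebasel form_f_ebaser /wt; case: ifP => _.
  by rewrite bar0 mulr0 addr0 mul1r.
by rewrite barK add0r.
Qed.

Lemma form_h_ebaser k v :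
  form_h v (ebase k) = wt (rev_ord k) * bar (v (rev_ord k) ord0).
Proof.
have := wt_cw (rev_ord k); have := cw_central (rev_ord k).
rewrite /cw rev_ordK => cwC wtK.
rewrite -form_h_bar form_h_ebasel barM -cwC -(wt_rev k) -mulrA (mulrA (wt k)).
by rewrite wtK mul1r.
Qed.

Lemma form_h0l v : form_h 0 v = 0.
Proof. by rewrite -[0 in LHS](vscale0 0) form_hZl bar0 mul0r. Qed.

Lemma form_h0r v : form_h v 0 = 0.
Proof. by rewrite -[0 in LHS](vscale0 0) form_hZr mulr0. Qed.

Lemma form_h_expandr u v : form_h u v = \sum_k form_h u (ebase k) * v k ord0.
Proof.
rewrite {1}(col_ebaseE v) (big_morph _ (fun v w => form_hDr v w u) (form_h0r u)).
by apply: eq_bigr => k _; rewrite form_hZr.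
Qed.

(* An Eichler transformation; mul_transv_mx gives its action. *)
Definition transv_mx h v a : 'M[A]_(2 * n) :=
  1%:M + v *m (ebase (rev_ord h))^T
  + ebase h *m (a *: (ebase (rev_ord h))^T
                - cw h *: \row_k form_h v (ebase k)).

Lemma mul_transv_mx h v a u :
  transv_mx h v a *m u =
  u + vscale v (u (rev_ord h) ord0)
    + vscale (ebase h) (a * u (rev_ord h) ord0 - cw h * form_h v u).
Proof.
have eTu k : (ebase k)^T *m u = (u k ord0)%:M.
  apply/matrixP=> i j; rewrite !ord1 !mxE eqxx mulr1n (bigD1 k) //= big1.
    by rewrite !mxE !eqxx mul1r addr0.
  by move=> l lk; rewrite !mxE (negPf lk) mul0r.
have vM w b : w *m b%:M = vscale w b.
  by apply/colP=> i; rewrite !mxE big_ord1 !mxE mulr1n.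
have hu : (\row_k form_h v (ebase k)) *m u = (form_h v u)%:M.
  apply/matrixP=> i j; rewrite !ord1 !mxE mulr1n (form_h_expandr v u).
  by apply: eq_bigr => k _; rewrite !mxE.
rewrite /transv_mx !mulmxDl mul1mx -!mulmxA mulmxBl -!scalemxAl eTu hu.
by rewrite !scale_scalar_mx -raddfB /= !vM.
Qed.

Lemma ebase_neq h k : h != k -> ebase h k ord0 = 0.
Proof. by rewrite ebaseE eq_sym => /negPf ->. Qed.

Lemma ebase_rev h : ebase h (rev_ord h) ord0 = 0.
Proof. exact/ebase_neq/rev_ord_neq. Qed.

(** As v and w vanish at -h, both factors preserve the coordinate at -h, and h(v, e_h) = 0; the only
    interaction left is h(v, w), which lands on e_h. *)
Lemma transv_mxM h v w a b :
    v (rev_ord h) ord0 = 0 -> w (rev_ord h) ord0 = 0 ->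
  transv_mx h v a *m transv_mx h w b
    = transv_mx h (v + w) (a + b - cw h * form_h v w).
Proof.
move=> v0 w0; apply: mulmx_ext => u; rewrite -mulmxA !mul_transv_mx.
have -> : (u + vscale w (u (rev_ord h) ord0)
  + vscale (ebase h) (b * u (rev_ord h) ord0 - cw h * form_h w u))
  (rev_ord h) ord0 = u (rev_ord h) ord0.
  by rewrite !mxE w0 [rev_ord h == h]eq_sym (negPf (rev_ord_neq h)) !mul0r !addr0.
set s := u _ _; rewrite !form_hDl !form_hDr !form_hZr form_h_ebaser v0 bar0 mulr0.
by apply/colP=> i; rewrite !mxE; ncring.
Qed.

Lemma transv_mx0 h : transv_mx h 0 0 = 1%:M.
Proof.
apply: mulmx_ext => u; rewrite mul_transv_mx.
by rewrite mul1mx; apply/colP=> i; rewrite !mxE form_h0l !mul0r !mulr0 subr0 mulr0 !addr0.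
Qed.
End UnitaryForms.

Arguments ebase {A n} k.
Arguments wt {A n} k.
Arguments cw {A n} h.

(** * Principal congruence subgroups: normality in GU and the level of their commutators *)

Section CongruenceSubgroups.
Local Open Scope ring_scope.
Variables (A : formRing) (n : nat).
Local Notation V := 'cV[A]_(2 * n).
Local Notation G := (GL A (2 * n)).
Implicit Types (I J Gam Del S : set A) (a b x y : A) (u v w : V) (g : G).
Implicit Types (h i j k : 'I_(2 * n)).

Definition act g v : V := GLmx g *m v.

Lemma act1 v : act 1%g v = v.
Proof. exact: mul1mx. Qed.

Lemma actM (g1 g2 : G) v : act (g1 * g2)%g v = act g1 (act g2 v).
Proof. by rewrite /act mulmxA. Qed.

Lemma actK g v : act g^-1%g (act g v) = v.
Proof. by rewrite -actM mulVg act1. Qed.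

Lemma actVK g v : act g (act g^-1%g v) = v.
Proof. by rewrite -actM mulgV act1. Qed.

Lemma actD g u v : act g (u + v) = act g u + act g v.
Proof. exact: mulmxDr. Qed.

Lemma actN g v : act g (- v) = - act g v.
Proof. exact: mulmxN. Qed.

Lemma act0 g : act g 0 = 0.
Proof. exact: mulmx0. Qed.

Lemma actZ g v a : act g (vscale v a) = vscale (act g v) a.
Proof. exact: mulmx_vscale. Qed.

Lemma act_inj (g1 g2 : G) : (forall v, act g1 v = act g2 v) -> g1 = g2.
Proof. by move=> e; apply: GLmx_inj; apply: mulmx_ext. Qed.

Definition preserves_h g := forall u v, form_h (act g u) (act g v) = form_h u v.

(** The sesquilinear form whose diagonal is phi_g; its off-diagonal values are the cross terms of
    phi_g. *)
Definition fdefect g u v : A := form_f (act g u) (act g v) - form_f u v.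

Local Notation phi g u := (fdefect g u u).

Lemma fdefectDl g u v w : fdefect g (u + v) w = fdefect g u w + fdefect g v w.
Proof. by rewrite /fdefect actD !form_fDl opprD addrACA. Qed.

Lemma fdefectDr g u v w : fdefect g w (u + v) = fdefect g w u + fdefect g w v.
Proof. by rewrite /fdefect actD !form_fDr opprD addrACA. Qed.

Lemma fdefectZl g u v a : fdefect g (vscale u a) v = bar a * fdefect g u v.
Proof. by rewrite /fdefect !actZ !form_fE mulrBr. Qed.

Lemma fdefectZr g u v a : fdefect g u (vscale v a) = fdefect g u v * a.
Proof. by rewrite /fdefect !actZ !form_fE mulrBl. Qed.

Lemma fdefect0l g u : fdefect g 0 u = 0.
Proof. by rewrite /fdefect act0 !form_fE subrr. Qed.

Lemma fdefect_skew g u v : preserves_h g ->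
  fdefect g u v = - (lam * bar (fdefect g v u)).
Proof.
move=> /(_ u v); rewrite /form_h /fdefect barB => e.
apply/eqP; rewrite -subr_eq0 opprK; apply/eqP.
have -> : form_f (act g u) (act g v) =
  form_f u v + lam * bar (form_f v u) - lam * bar (form_f (act g v) (act g u)).
  by rewrite -e addrK.
by ncring.
Qed.

Lemma fdefect_diagD g u v : preserves_h g ->
  phi g (u + v) = phi g u + phi g v
                  + (fdefect g v u - lam * bar (fdefect g v u)).
Proof.
by move=> gh; rewrite fdefectDl !fdefectDr (fdefect_skew u v gh); ncring.
Qed.

Lemma fdefectM (g1 g2 : G) u :
  phi (g1 * g2)%g u = phi g1 (act g2 u) + phi g2 u.
Proof. by rewrite /fdefect actM addrA addrNK. Qed.

Lemma fdefectV g u : phi g^-1%g u = - phi g (act g^-1%g u).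
Proof. by rewrite /fdefect actVK opprB. Qed.

Lemma skewD x y :
  (x + y) - lam * bar (x + y) = (x - lam * bar x) + (y - lam * bar y) :> A.
Proof. by rewrite barD mulrDr opprD addrACA. Qed.

(** Expanding v in the basis splits phi_g(v) into sandwiched values phi_g(e_i) and cross terms,
    which have the form x - lam bar(x) by [fdefect_diagD]. *)
Lemma fdefect_diag_mem S g v :
    additive_subgroup S -> preserves_h g ->
    (forall i, S (bar (v i ord0) * phi g (ebase i) * v i ord0)) ->
    (forall i j, let x := bar (v i ord0) * fdefect g (ebase i) (ebase j)
                          * v j ord0 in S (x - lam * bar x)) ->
  S (phi g v).
Proof.
move=> [S0 SD SN] gh Sdiag Sskew; rewrite (col_ebaseE v).
have Scross k r : let x := fdefect g
    (\sum_(i <- r) vscale (ebase i) (v i ord0)) (vscale (ebase k) (v k ord0))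
    in S (x - lam * bar x).
  elim: r => [|i r IHr] /=.
    by rewrite big_nil fdefect0l bar0 mulr0 subrr.
  rewrite big_cons fdefectDl skewD; apply: SD => //.
  by rewrite fdefectZl fdefectZr mulrA; apply: Sskew.
elim: (index_enum _) => [|k r IHr]; first by rewrite big_nil fdefect0l.
rewrite big_cons (fdefect_diagD _ _ gh); apply: (SD) => //; apply: SD => //.
by rewrite fdefectZl fdefectZr mulrA.
Qed.

Lemma GUP g : GU n g <-> preserves_h g /\ forall u, Lam (phi g u).
Proof. by []. Qed.

Lemma GU_subgroup : subgroup (GU (A := A) n).
Proof.
have [L0 LD LN] := Lam_additive A.
split; first by apply/GUP; split=> [u v|u]; rewrite /fdefect !act1 ?subrr.
  move=> g1 g2 /GUP[h1 q1] /GUP[h2 q2]; apply/GUP; split=> [u v|u].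
    by rewrite !actM h1 h2.
  by rewrite fdefectM; apply: LD.
move=> g /GUP[gh gq]; apply/GUP; split=> [u v|u].
  by have := gh (act g^-1%g u) (act g^-1%g v); rewrite !actVK => ->.
by rewrite fdefectV; apply: LN.
Qed.

Definition vec_in I v := forall i, I (v i ord0).

Lemma vec_inD I u v : additive_subgroup I ->
  vec_in I u -> vec_in I v -> vec_in I (u + v).
Proof. by case=> _ ID _ Iu Iv i; rewrite mxE; apply: ID. Qed.

Lemma vec_inN I v : additive_subgroup I -> vec_in I v -> vec_in I (- v).
Proof. by case=> _ _ IN Iv i; rewrite mxE; apply: IN. Qed.

Lemma form_f_mem S u v : additive_subgroup S ->
  (forall i j, S (bar (u i ord0) * v j ord0)) -> S (form_f u v).
Proof. by move=> Ssub Suv; apply: addsub_sum. Qed.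

Section RelativeUnitaryGroups.
Variables I Gam : set A.
Hypothesis hI : form_ideal I Gam.
Let Isub := level_subgroup hI.
Let Gsub := param_subgroup hI.

Lemma vec_in_mulmx (M : 'M[A]_(2 * n)) v : vec_in I v -> vec_in I (M *m v).
Proof.
move=> Iv i; rewrite mxE; apply: addsub_sum => // j _; exact: (level_mull hI).
Qed.

Lemma vec_in_vscale v a : I a -> vec_in I (vscale v a).
Proof. by move=> Ia i; rewrite mxE; apply: (level_mull hI). Qed.

Lemma form_f_inl u v : vec_in I u -> I (form_f u v).
Proof.
move=> Iu; apply: form_f_mem => // i j.
by apply: (level_mulr hI); apply: (level_bar hI).
Qed.

Lemma form_f_inr u v : vec_in I v -> I (form_f u v).
Proof. by move=> Iv; apply: form_f_mem => // i j; apply: (level_mull hI). Qed.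

Lemma fdefect_in g u v : (forall u, vec_in I (act g u - u)) -> I (fdefect g u v).
Proof.
move=> gI; have [_ ID _] := Isub.
have -> : fdefect g u v = form_f (act g u - u) (act g v) + form_f u (act g v - v).
  by rewrite /fdefect !form_fE; ncring.
by apply: ID; [apply: form_f_inl | apply: form_f_inr].
Qed.

(** The values phi_g(e_i) lie in Lam and the coordinates of v in I, so the expansion of phi_g(v)
    consists of elements of [Gam_min I]. *)
Lemma fdefect_GU g v : GU n g -> vec_in I v -> Gam (phi g v).
Proof.
move=> /GUP[gh gq] Iv; apply: fdefect_diag_mem => // [i|i j] /=.
  rewrite -[X in _ * X]barK.
  by apply: (param_sandwich hI); first exact: (level_bar hI).
by apply: (param_skew hI); apply: (level_mull hI).
Qed.

Lemma GU_relP g : GU_rel n I Gam g <->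
  [/\ GU n g, forall u, vec_in I (act g u - u) & forall u, Gam (phi g u)].
Proof.
split=> [[gU gI gG]|[gU gI gG]]; split=> //.
  move=> u i; have -> : act g u - u = (GLmx g - 1%:M) *m u.
    by rewrite mulmxBl mul1mx.
  rewrite mxE; apply: addsub_sum => // j _; apply: (level_mulr hI).
  by rewrite !mxE; have := gI i j; rewrite !mxE.
move=> i j; have := gI (ebase j) i.
by rewrite /act /ebase -colE !mxE andbT.
Qed.

Lemma GU_rel_subgroup : subgroup (GU_rel n I Gam).
Proof.
have [U1 UM UV] := GU_subgroup.
have [G0 GD GN] := Gsub; have [I0 ID IN] := Isub.
split; first apply/GU_relP.
- split=> // u; last by rewrite /fdefect act1 subrr.
  by rewrite act1 subrr => i; rewrite mxE.
- move=> g1 g2 /GU_relP[U_1 I_1 G_1] /GU_relP[U_2 I_2 G_2]; apply/GU_relP.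
  split=> [|u|u]; [exact: UM| |by rewrite fdefectM; apply: GD].
  have -> : act (g1 * g2)%g u - u
      = (act g1 (act g2 u) - act g2 u) + (act g2 u - u).
    by rewrite actM addrA addrNK.
  exact: vec_inD.
- move=> g /GU_relP[Ug Ig Gg]; apply/GU_relP.
  split=> [|u|u]; [exact: UV| |by rewrite fdefectV; apply: GN].
  by rewrite -opprB -{1}(actVK g u); apply: vec_inN.
Qed.

Lemma GU_rel_conj g (x : G) : GU n g -> GU_rel n I Gam x ->
  GU_rel n I Gam (g * x * g^-1)%g.
Proof.
move=> Ug /GU_relP[Ux Ix Gx]; have [_ UM UV] := GU_subgroup.
have [G0 GD GN] := Gsub; have [I0 ID IN] := Isub.
apply/GU_relP; split=> [|u|u].
- by apply: (UM) => [|]; [exact: UM | exact: UV].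
- rewrite -{2}(actVK g u) !actM -actN -actD; exact: vec_in_mulmx.
(* The contributions of g and of its inverse combine to phi_g(xw) - phi_g(w), where xw differs from
   w by a vector over I. *)
- set w := act g^-1%g u.
  have -> : phi (g * x * g^-1)%g u = phi g (act x w) - phi g w + phi x w.
    by rewrite !fdefectM fdefectV -/w; ncring.
  have /GUP[gh _] := Ug.
  apply: (GD) => //.
  rewrite -[act x w](subrK w) (fdefect_diagD _ _ gh).
  set z := act x w - w; have Iz : vec_in I z by apply: Ix.
  have -> : phi g z + phi g w + (fdefect g w z - lam * bar (fdefect g w z))
    - phi g w = phi g z + (fdefect g w z - lam * bar (fdefect g w z)).
    by ncring.
  apply: GD; first exact: fdefect_GU.
  apply: (param_skew hI); apply: addsubB => //; apply: form_f_inr => //.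
  exact: vec_in_mulmx.
Qed.

End RelativeUnitaryGroups.

Lemma GU_rel_shift I Gam J S g v : additive_subgroup S ->
    (forall x y, I x -> J y -> S (x * y)) ->
  GU_rel n I Gam g -> vec_in J v -> vec_in S (act g v - v).
Proof.
move=> Ssub IJS [_ gI _] Jv i.
have -> : act g v - v = (GLmx g - 1%:M) *m v by rewrite mulmxBl mul1mx.
rewrite mxE; apply: addsub_sum => // j _; apply: IJS => //.
by rewrite !mxE; have := gI i j; rewrite !mxE.
Qed.

(** The difference is phi_g(v) plus a cross term. The target (S, Om) is kept abstract so that the
    lemma applies to the two form ideals in either order. *)
Lemma fdefect_shift I Gam J Del S Om g u v :
    form_ideal I Gam -> form_ideal J Del -> form_ideal S Om ->
    (forall x y, I x -> J y -> S (x * y)) ->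
    (forall x y, I x -> J y -> S (y * x)) ->
    (forall x a, J x -> Gam a -> Om (x * a * bar x)) ->
  GU_rel n I Gam g -> vec_in J v -> Om (phi g (v + u) - phi g u).
Proof.
move=> hI hJ hS IJS JIS Ssand gR Jv.
have /(GU_relP hI)[/GUP[gh _] Ig Gg] := gR.
have Osub := param_subgroup hS; have [_ OD _] := Osub.
have Ssub := level_subgroup hS; have [_ SD _] := Ssub.
rewrite (fdefect_diagD _ _ gh) addrAC addrK addrC; apply: OD.
  apply: (param_skew hS).
  have -> : fdefect g u v = form_f (act g u - u) (act g v) + form_f u (act g v - v).
    by rewrite /fdefect !form_fE; ncring.
  apply: SD; last by apply: (form_f_inr hS); apply: GU_rel_shift gR Jv.
  apply: form_f_mem => // i j; apply: IJS; first exact/(level_bar hI)/Ig.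
  exact: (vec_in_mulmx hJ).
apply: fdefect_diag_mem => // [i|i j] /=.
  by rewrite -[X in _ * X]barK; apply: Ssand => //; apply: (level_bar hJ).
apply: (param_skew hS); apply: (level_mulr hS).
by apply: JIS; [exact: (fdefect_in hI) | exact: (level_bar hJ)].
Qed.

Lemma comm_GU_rel I Gam J Del : form_ideal I Gam -> form_ideal J Del ->
  comm_subgroup (GU_rel n I Gam) (GU_rel n J Del)
    `<=` GU_rel n (symm_ideal I J) (symm_param I Gam J Del).
Proof.
move=> hI hJ; have hK := symm_form_ideal hI hJ.
set K := symm_ideal I J; set Om := symm_param _ _ _ _.
have Ksub := level_subgroup hK; have Osub := param_subgroup hK.
apply: smallest_sub (GU_rel_subgroup hK) _ => _ [x xR [y yR <-]].
have [_ UM UV] := GU_subgroup.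
have /(GU_relP hI)[xU xI xG] := xR; have /(GU_relP hJ)[yU yI yG] := yR.
set c := (x * y * x^-1 * y^-1)%g.
have cyx : (c * (y * x) = x * y)%g by rewrite /c !mulgA !mulgVK.
(* Testing c = [x, y] on vectors of the form (yx)w replaces c by the comparison of xy with yx and
   removes the inverses. *)
have uE u : u = act (y * x)%g (act (y * x)^-1%g u) by rewrite actVK.
apply/(GU_relP hK); split=> [|u|u].
- by apply: (UM) => [|]; [apply: (UM) => [|]; [exact: UM|exact: UV]|exact: UV].
- rewrite {}(uE u); move: (act _ u) => w; rewrite -actM cyx !actM.
  (* This is xy - yx = (x - 1)(y - 1) - (y - 1)(x - 1), whose terms have entries in IJ and JI. *)
  have -> : act x (act y w) - act y (act x w) =
      (act x (act y w - w) - (act y w - w)) - (act y (act x w - w) - (act x w - w)).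
    rewrite !actD !actN; move: (act x (act y w)) (act y (act x w)) => a b.
    by move: (act x w) (act y w) => p q; apply/colP=> i; rewrite !mxE; ncring.
  apply: vec_inD => //; last apply: vec_inN => //.
    by apply: (GU_rel_shift (J := J)) xR _ => // a b; apply: symm_ideall.
  by apply: (GU_rel_shift (J := I)) yR _ => // a b Ja Ib; apply: symm_idealr.
- rewrite {}(uE u); move: (act _ u) => w.
  (* The value is phi_{xy}(w) - phi_{yx}(w); after expanding both products it is regrouped into one
     shift for x and one for y. *)
  have -> : phi c (act (y * x)%g w) =
    (phi x ((act y w - w) + w) - phi x w) - (phi y ((act x w - w) + w) - phi y w).
    rewrite !subrK; apply: (addIr (phi (y * x)%g w)).
    by rewrite -fdefectM cyx !fdefectM; ncring.
  apply: addsubB => //.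
    apply: (fdefect_shift _ hI hJ hK _ _ _ xR) => //.
    + by move=> a b; apply: symm_ideall.
    + by move=> a b; apply: symm_idealr.
    + by move=> a b; apply: symm_param_l.
  apply: (fdefect_shift _ hJ hI hK _ _ _ yR) => //.
  + by move=> a b Ja Ib; apply: symm_idealr.
  + by move=> a b Ja Ib; apply: symm_ideall.
  + by move=> a b; apply: symm_param_r.
Qed.

End CongruenceSubgroups.

Arguments preserves_h {A n} g.
Arguments vec_in {A n} I v.

(** * Eichler transformations *)

Section EichlerTransformations.
Local Open Scope ring_scope.
Variables (A : formRing) (n : nat).
Local Notation V := 'cV[A]_(2 * n).
Local Notation G := (GL A (2 * n)).
Implicit Types (I J Gam Del S : set A) (a b c d x y : A) (u v w : V) (g : G).
Implicit Types (h i j k : 'I_(2 * n)).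
Local Notation phi g u := (fdefect g u u).

Lemma wt_inj k x y : wt k * x = wt k * y -> x = y.
Proof.
move=> e; have := congr1 ( *%R (cw (rev_ord k))) e.
by rewrite !mulrA cw_central -[k in wt k]rev_ordK wt_cw !mul1r.
Qed.

Lemma form_f_ebase k l : k != rev_ord l -> form_f (ebase k : V) (ebase l) = 0.
Proof.
move=> kl; rewrite form_f_ebasel; case: ifP => // _; apply: ebase_neq.
by apply: contra kl => /eqP ->; rewrite rev_ordK.
Qed.

Lemma form_f_ebase_perpl k v : v (rev_ord k) ord0 = 0 -> form_f (ebase k) v = 0.
Proof. by move=> v0; rewrite form_f_ebasel v0 if_same. Qed.

Lemma form_f_ebase_perpr k v : v (rev_ord k) ord0 = 0 -> form_f v (ebase k) = 0.
Proof. by move=> v0; rewrite form_f_ebaser v0 bar0 if_same. Qed.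

Lemma vscale1 v : vscale v 1 = v.
Proof. by apply/colP=> i; rewrite mxE mulr1. Qed.

Definition perp h v := v h ord0 = 0 /\ v (rev_ord h) ord0 = 0.

Lemma perpD h u v : perp h u -> perp h v -> perp h (u + v).
Proof. by case=> u1 u2 [v1 v2]; split; rewrite mxE ?u1 ?u2 ?v1 ?v2 addr0. Qed.

Lemma perpN h v : perp h v -> perp h (- v).
Proof. by case=> v1 v2; split; rewrite mxE ?v1 ?v2 oppr0. Qed.

Lemma perp0 h : perp h 0.
Proof. by split; rewrite mxE. Qed.

Lemma perp_ebase h k a : k != h -> k != rev_ord h -> perp h (vscale (ebase k) a).
Proof. by move=> kh krh; split; rewrite mxE ebase_neq ?mul0r // eq_sym. Qed.

(* The parameter c of the Eichler transformation is normalised so that it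
   ranges over Lam, for every v orthogonal to e_h and e_{-h}. *)
Definition esd h v c : G :=
  let a := cw h * (c - form_f v v) in
  insubd (1%g : G) (transv_mx h v a, transv_mx h (- v) (- a - cw h * form_h v v)).

(** Orthogonality makes the two matrices in [esd] mutually inverse, so the default value of [insubd]
    is not taken. *)
Lemma GLmx_esd h v c : perp h v ->
  GLmx (esd h v c) = transv_mx h v (cw h * (c - form_f v v)).
Proof.
case=> _ v0; rewrite /GLmx /esd /=; set a := cw h * _.
have Nv0 : (- v) (rev_ord h) ord0 = 0 by rewrite mxE v0 oppr0.
rewrite -[GL_pair _]/(val _) insubdK // unfold_in /GL_pred /= !transv_mxM //.
rewrite form_hNl form_hNr mulrN opprK subrr addNr.
rewrite -addrA addrNK subrr [- _ - _ + _]addrAC addNr sub0r addNr.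
by rewrite transv_mx0 eqxx.
Qed.

Lemma act_esd h v c u : perp h v ->
  act (esd h v c) u = u + vscale v (u (rev_ord h) ord0)
    + vscale (ebase h) (cw h * (c - form_f v v) * u (rev_ord h) ord0
                        - cw h * form_h v u).
Proof. by move=> hv; rewrite /act GLmx_esd // mul_transv_mx. Qed.

Lemma GLmxM (g1 g2 : G) : GLmx (g1 * g2)%g = GLmx g1 *m GLmx g2.
Proof. by []. Qed.

(** The term -h(v, w) of [transv_mxM] combines with the cross terms of f(v + w, v + w) to an element
    x - lam bar(x), so parameters add modulo such elements. *)
Lemma esdM h v w c d : perp h v -> perp h w ->
  (esd h v c * esd h w d)%g
    = esd h (v + w) (c + d + (form_f w v - lam * bar (form_f w v))).
Proof.
move=> hv hw; apply: GLmx_inj; rewrite GLmx_esd; last exact: perpD.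
rewrite GLmxM !GLmx_esd // transv_mxM; last first.
- by case: hw. - by case: hv.
by congr transv_mx; rewrite !form_fE /form_h; ncring.
Qed.

Lemma esd0 h : esd h 0 0 = 1%g.
Proof.
apply: GLmx_inj; rewrite GLmx_esd; last exact: perp0.
by rewrite form_f0l subrr mulr0 transv_mx0.
Qed.

Lemma esd_cM h v c d : perp h v -> (esd h 0 c * esd h v d)%g = esd h v (c + d).
Proof.
move=> hv; rewrite esdM ?add0r //; last exact: perp0.
by rewrite form_f0r bar0 mulr0 subr0 addr0.
Qed.

Section Stabiliser.
Variable h : 'I_(2 * n).

(** The Levi subgroup shared by the two opposite parabolic subgroups at h and -h. *)
Definition levi : set G :=
  [set g | [/\ GU n g, act g (ebase h) = ebase h
             & act g (ebase (rev_ord h)) = ebase (rev_ord h)]].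

Lemma levi_GU g : levi g -> GU n g.
Proof. by case. Qed.

Lemma levi1 : levi 1%g.
Proof. by split; rewrite ?act1 //; case: (@GU_subgroup A n). Qed.

Lemma leviM g1 g2 : levi g1 -> levi g2 -> levi (g1 * g2)%g.
Proof.
have [_ UM _] := @GU_subgroup A n.
by case=> ? e1 e1' [? e2 e2']; split; rewrite ?actM ?e2 ?e2' //; apply: UM.
Qed.

Lemma leviV g : levi g -> levi g^-1%g.
Proof.
have [_ _ UV] := @GU_subgroup A n.
case=> ? e1 e2; split; first exact: UV.
  by rewrite -{1}e1 actK.
by rewrite -{1}e2 actK.
Qed.

(** Up to the unit [wt h], the coordinate at -h is h(e_h, u), and g preserves both h and e_h. *)
Lemma levi_coord g u : levi g -> act g u (rev_ord h) ord0 = u (rev_ord h) ord0.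
Proof.
case=> /GUP[gh _] e1 _; apply: (@wt_inj h).
by rewrite -!form_h_ebasel -{1}e1 gh.
Qed.

Lemma levi_coord' g u : levi g -> act g u h ord0 = u h ord0.
Proof.
case=> /GUP[gh _] _ e2; apply: (@wt_inj (rev_ord h)).
by have := gh (ebase (rev_ord h)) u; rewrite e2 !form_h_ebasel rev_ordK.
Qed.

Lemma levi_perp g v : levi g -> perp h v -> perp h (act g v).
Proof. by move=> Lg [v1 v2]; split; rewrite ?levi_coord // levi_coord'. Qed.

(** Conjugation leaves the matrix coefficient c - f(v, v) unchanged while v becomes gv, which forces
    the parameter c + phi_g(v). *)
Lemma esd_conj g v c : levi g -> perp h v ->
  (g * esd h v c * g^-1)%g = esd h (act g v) (c + phi g v).
Proof.
move=> Lg hv; apply: (mulIg g); rewrite mulgVK; apply: act_inj => u.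
have [/GUP[gh _] e1 _] := Lg.
rewrite !actM !act_esd //; last exact: levi_perp.
rewrite gh levi_coord // !actD !actZ e1; congr (_ + _); congr (vscale _ _).
by congr (_ * _ * _ - _); rewrite /fdefect; ncring.
Qed.

End Stabiliser.

Lemma levi_rev h : levi (rev_ord h) `<=` levi h.
Proof. by move=> g []; rewrite rev_ordK. Qed.

Lemma esd_preserves_h h v c : perp h v -> Lam c -> preserves_h (esd h v c).
Proof.
move=> hv Lc u w; have [v1 v2] := hv; rewrite !act_esd //.
set s := u _ _; set s' := w _ _; set a := cw h * _.
set t := _ - cw h * form_h v u; set t' := _ - _.
(* This is the coefficient between bar(s) and s' in the change of h; it reduces to c + lam bar(c),
   which vanishes on Lam. *)
have key : wt (rev_ord h) * a + form_h v v + bar a * wt h = 0.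
  rewrite /a mulrA wt_cw mul1r barM bar_cw -mulrA wt_rev -lam_central barB.
  by rewrite mulrBr Lam_bar // /form_h; ncring.
have E1 : wt (rev_ord h) * bar s * t'
    = bar s * (wt (rev_ord h) * a) * s' - bar s * form_h v w.
  rewrite /t' mulrBr; congr (_ - _); first by rewrite wt_central !mulrA.
  by rewrite wt_central mulrA -(mulrA (bar s)) wt_cw mulr1.
have E2 : bar t * (wt h * s') = bar s * (bar a * wt h) * s' - form_h u v * s'.
  rewrite /t barB mulrBl !barM bar_cw; congr (_ - _); first by rewrite !mulrA.
  by rewrite -(form_h_bar v u) !mulrA -(mulrA (bar _)) wt_rev lam_central.
have E0 : bar s * (wt (rev_ord h) * a + form_h v v + bar a * wt h) * s' = 0.
  by rewrite key mulr0 mul0r.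
rewrite !form_hDl !form_hDr !form_hZl !form_hZr !form_h_ebasel !form_h_ebaser.
rewrite -/s -/s' v2 bar0 ebase_rev !(mulr0, mul0r) !addr0 E1 E2.
apply/eqP; rewrite -subr_eq0 -[X in _ == X]E0; apply/eqP; ncring.
Qed.

Lemma esd_GU_rel I Gam h v c : form_ideal I Gam ->
  perp h v -> vec_in I v -> Gam c -> GU_rel n I Gam (esd h v c).
Proof.
move=> hI hv Iv Gc; have Isub := level_subgroup hI; have Gsub := param_subgroup hI.
have [v1 v2] := hv; have [I0 ID IN] := Isub; have [G0 GD GN] := Gsub.
have eh := esd_preserves_h hv (param_Lam hI Gc).
have eI u : vec_in I (act (esd h v c) u - u).
  rewrite act_esd // addrAC [u + _]addrC addrK; apply: vec_inD => // [i|].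
    by rewrite mxE; apply: (level_mulr hI).
  apply: (vec_in_vscale hI); apply: addsubB => //; last first.
    apply: (level_mull hI); apply: ID; first exact: (form_f_inl hI).
    by apply/(level_mull hI)/(level_bar hI)/(form_f_inr hI).
  apply: (level_mulr hI); apply: (level_mull hI); apply: addsubB => //.
    exact: (param_level hI Gc).
  exact: (form_f_inl hI).
have eG u : Gam (phi (esd h v c) u).
  apply: fdefect_diag_mem => // [i|i j] /=; last first.
    by apply/(param_skew hI)/(level_mulr hI)/(level_mull hI)/(fdefect_in hI).
  apply: (param_stable_bar hI); rewrite /fdefect act_esd // ebaseE.
  (* On the basis, phi can be nonzero only at e_{-h}, the one basis vector with a nonzero coordinate
     at -h. *)
  have [->|ih] := eqVneq i (rev_ord h).
    rewrite mulr1n vscale1 mulr1 form_h_ebaser rev_ordK v1 bar0 !mulr0 subr0.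
    set a := cw h * _.
    have ee k : form_f (ebase k : V) (ebase k) = 0 by apply/form_f_ebase/rev_ord_neq.
    have ev := form_f_ebase_perpl v2; have ve := form_f_ebase_perpr v2.
    have ev' : form_f (ebase (rev_ord h)) v = 0.
      by apply: form_f_ebase_perpl; rewrite rev_ordK.
    have ve' : form_f v (ebase (rev_ord h)) = 0.
      by apply: form_f_ebase_perpr; rewrite rev_ordK.
    rewrite !form_fE !ee ev ve ev' ve'.
    rewrite !form_f_ebasel !ebaseE rev_ordK !eqxx /a /cw /wt rev_ord_lt.
    rewrite !(mulr0, mul0r, add0r, addr0, subr0).
    (* For positive h the coefficient of e_h enters through [bar] and yields -c up to x - lam bar(x)
       with x = f(v, v); for negative h the value is c itself. *)
    case: (h < n)%N => /=; rewrite ?mulr1n ?mulr0 ?mul0r ?addr0 ?add0r.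
      have -> : form_f v v + bar (bar lam * (c - form_f v v)) * 1
        = (form_f v v - lam * bar (form_f v v)) - c.
        rewrite mulr1 barM barK -lam_central barB mulrBr Lam_bar //.
          by ncring.
        exact: (param_Lam hI).
      apply: addsubB => //; apply: (param_skew hI); exact: (form_f_inl hI).
    have -> : 1 * (bar 1 * (c - form_f v v)) + form_f v v = c.
      by rewrite bar1; ncring.
    exact: Gc.
  rewrite mulr0n vscale0 mulr0 addr0 sub0r.
  have ei : form_f (ebase i) (ebase i) = 0 :> A by apply/form_f_ebase/rev_ord_neq.
  have hh : form_f (ebase h) (ebase h) = 0 :> A by apply/form_f_ebase/rev_ord_neq.
  rewrite !form_fE ei hh (form_f_ebase ih) (form_f_ebase (k := h)).
    by rewrite !(mul0r, mulr0, addr0, subrr).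
  by apply: contra ih => /eqP ->; rewrite rev_ordK.
apply/(GU_relP hI); split=> //; apply/GUP; split=> // u.
exact: (param_Lam hI (eG u)).
Qed.

End EichlerTransformations.

Arguments perp {A n} h v.
Arguments levi {A n} h.

(** * Elementary generators as Eichler transformations, and the groups FU and EU *)

Section ElementaryGenerators.
Local Open Scope ring_scope.
Variables (A : formRing) (n : nat).
Local Notation V := 'cV[A]_(2 * n).
Local Notation G := (GL A (2 * n)).
Implicit Types (I J Gam Del S : set A) (a b c d x y z : A) (u v w : V) (g : G).
Implicit Types (h i j k l p : 'I_(2 * n)).
Local Notation phi g u := (fdefect g u u).

Lemma mul_delta_mx_col i j a u :
  (a *: delta_mx i j) *m u = vscale (ebase i) (a * u j ord0).
Proof.
apply/colP=> k; rewrite !mxE (bigD1 j) //= big1 ?addr0.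
  rewrite !mxE !eqxx !andbT; case: (k == i); rewrite /= ?mulr1n ?mulr0n.
    by rewrite mulr1 mul1r.
  by rewrite mulr0 !mul0r.
by move=> l lj; rewrite !mxE (negPf lj) andbF mulr0 mul0r.
Qed.

Lemma lam_pow_twist h : lam_pow (- ((eps h + 1) %/ 2)%Z) = cw h :> A.
Proof.
rewrite /eps /cw /wt rev_ord_lt; case: (h < n)%N => /=; rewrite ?bar1.
  by rewrite [LHS](_ : _ = bar (lam : A) ^+ 1) ?expr1.
by rewrite expr0.
Qed.

Lemma lam_pow_short i j :
  lam_pow ((eps j - eps i) %/ 2)%Z = cw (rev_ord j) * wt i :> A.
Proof.
rewrite /eps /cw rev_ordK /wt; case: (j < n)%N; case: (i < n)%N => /=.
- by rewrite [LHS](_ : _ = (lam : A) ^+ 0) ?expr0 ?bar1 ?mul1r.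
- by rewrite [LHS](_ : _ = (lam : A) ^+ 1) ?expr1 ?bar1 ?mul1r.
- by rewrite [LHS](_ : _ = bar (lam : A) ^+ 1) ?expr1 ?mulr1.
- by rewrite [LHS](_ : _ = (lam : A) ^+ 0) ?expr0 ?bar_lam_lam.
Qed.

Lemma GLmx_esd_long h c :
  GLmx (esd h 0 c) = T_long h (lam_pow (- ((eps h + 1) %/ 2)%Z) * c).
Proof.
apply: mulmx_ext => u; rewrite -/(act _ _) act_esd; last exact: perp0.
rewrite /T_long mulmxDl mul1mx mul_delta_mx_col lam_pow_twist form_f0r subr0.
rewrite form_h0l mulr0 subr0; congr (_ + _).
by apply/colP=> i; rewrite !mxE mul0r addr0.
Qed.

Lemma act_esd_short h k x u : k != h -> k != rev_ord h ->
  act (esd h (vscale (ebase k) x) 0) u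
  = u + vscale (ebase k) (x * u (rev_ord h) ord0)
    - vscale (ebase h) (cw h * wt k * bar x * u (rev_ord k) ord0).
Proof.
move=> kh krh; rewrite act_esd; last exact: perp_ebase.
rewrite vscaleA; congr (_ + _).
rewrite !form_fE form_f_ebase ?rev_ord_neq // mul0r mulr0 subr0 mulr0 mul0r sub0r.
rewrite form_hZl form_h_ebasel.
have -> : cw h * (bar x * (wt k * u (rev_ord k) ord0))
        = cw h * wt k * bar x * u (rev_ord k) ord0.
  by rewrite !mulrA -(mulrA (cw h) (bar x)) -wt_central mulrA.
by apply/colP=> i; rewrite !mxE mulrN.
Qed.

Lemma GLmx_esd_short i j x : i != j -> i != rev_ord j ->
  GLmx (esd (rev_ord j) (vscale (ebase i) x) 0) = T_short i j x.
Proof.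
move=> ij irj; apply: mulmx_ext => u; rewrite -/(act _ _).
rewrite act_esd_short ?rev_ordK // /T_short !mulmxDl mul1mx mulNmx.
by rewrite !mul_delta_mx_col lam_pow_short.
Qed.

(* T_{k,-h}(x) belongs to the unipotent radicals attached to h and to k. *)
Lemma esd_swap h k x : k != h -> k != rev_ord h ->
  esd h (vscale (ebase k) x) 0
    = esd k (vscale (ebase h) (- (cw h * wt k * bar x))) 0 :> G.
Proof.
move=> kh krh; have hk : h != k by rewrite eq_sym.
have hrk : h != rev_ord k by apply: contra krh => /eqP ->; rewrite rev_ordK.
apply: act_inj => u; rewrite !act_esd_short // !mulNr.
have -> : cw k * wt h * bar (- (cw h * wt k * bar x)) = - x.
  rewrite barN !barM barK bar_cw mulrN.
  have -> : cw k * wt h * (x * (bar (wt k) * wt (rev_ord h)))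
    = x * ((cw k * bar (wt k)) * (wt (rev_ord h) * wt h)).
    rewrite -(mulrA (cw k)) cw_central (wt_central h) -!mulrA; congr (_ * _).
    by rewrite (wt_central h) !mulrA -(cw_central k) !mulrA.
  by rewrite wt_rev /cw -barM -{1}[k]rev_ordK wt_rev bar_lam_lam mulr1.
by apply/colP=> i; rewrite !mxE !(mulNr, mulrN) opprK addrAC.
Qed.

(** T_{ij}(x) is the transformation at -j along e_i x, and a long generator is one along the zero
    vector; the normalisation of [esd] absorbs the twist by lam. *)
Lemma elementaryP I Gam g : elementary n I Gam g <->
  (exists h k x, [/\ k != h, k != rev_ord h, I x
                   & g = esd h (vscale (ebase k) x) 0])
  \/ (exists h c, Gam c /\ g = esd h 0 c).
Proof.
split.
  case=> [[i [j [x [ij irj Ix e]]]]|[h [_ [[c Gc <-] e]]]]; [left|right].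
    exists (rev_ord j), i, x; rewrite rev_ordK; split=> //.
    by apply: GLmx_inj; rewrite GLmx_esd_short.
  by exists h, c; split=> //; apply: GLmx_inj; rewrite GLmx_esd_long.
case=> [[h [k [x [kh krh Ix ->]]]]|[h [c [Gc ->]]]]; [left|right].
  exists k, (rev_ord h), x; rewrite rev_ordK; split=> //.
  by rewrite -[h in LHS]rev_ordK GLmx_esd_short // rev_ordK.
exists h, (lam_pow (- ((eps h + 1) %/ 2)%Z) * c); rewrite GLmx_esd_long.
by split=> //; exists c.
Qed.

Lemma vscaleDr v x y : vscale v (x + y) = vscale v x + vscale v y.
Proof. by apply/colP=> i; rewrite !mxE mulrDr. Qed.

Lemma esd_ebaseD h k x y : k != h -> k != rev_ord h ->
  esd h (vscale (ebase k) (x + y)) 0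
    = (esd h (vscale (ebase k) x) 0 * esd h (vscale (ebase k) y) 0)%g :> G.
Proof.
move=> kh krh; have px := perp_ebase x kh krh; have py := perp_ebase y kh krh.
rewrite (esdM _ _ px py) !form_fE (form_f_ebase A (rev_ord_neq k)).
by rewrite mul0r mulr0 bar0 mulr0 subr0 !addr0 vscaleDr.
Qed.

Lemma subgroup_esd_short (H : set G) h k : subgroup H -> k != h -> k != rev_ord h ->
  additive_subgroup [set x | H (esd h (vscale (ebase k) x) 0)].
Proof.
move=> [H1 HM HV] kh krh; split=> [|x y Hx Hy|x Hx] /=.
- by rewrite vscale0 esd0.
- by rewrite esd_ebaseD //; apply: HM.
- have -> : esd h (vscale (ebase k) (- x)) 0 = (esd h (vscale (ebase k) x) 0)^-1%g.
    apply: (mulgI (esd h (vscale (ebase k) x) 0)).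
    by rewrite mulgV -esd_ebaseD // subrr vscale0 esd0.
  exact: HV.
Qed.

Lemma subgroup_esd_long (H : set G) h : subgroup H ->
  additive_subgroup [set c | H (esd h 0 c)].
Proof.
move=> [H1 HM HV]; split=> [|x y Hx Hy|x Hx] /=; first by rewrite esd0.
  by rewrite -esd_cM; [apply: HM | exact: perp0].
have -> : esd h 0 (- x) = (esd h 0 x)^-1%g.
  apply: (mulgI (esd h 0 x)); rewrite mulgV esd_cM; last exact: perp0.
  by rewrite subrr esd0.
exact: HV.
Qed.

Lemma elementaryV I Gam g : additive_subgroup I -> additive_subgroup Gam ->
  elementary n I Gam g -> elementary n I Gam g^-1%g.
Proof.
move=> [_ _ IN] [_ _ GN].
case/elementaryP=> [[h [k [x [kh krh Ix ->]]]]|[h [c [Gc ->]]]]; apply/elementaryP.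
  left; exists h, k, (- x); split=> //; first exact: IN.
  apply/esym; apply: (mulgI (esd h (vscale (ebase k) x) 0)).
  by rewrite mulgV -esd_ebaseD // subrr vscale0 esd0.
right; exists h, (- c); split; first exact: GN.
apply/esym; apply: (mulgI (esd h 0 c)); rewrite mulgV esd_cM; last exact: perp0.
by rewrite subrr esd0.
Qed.

Section FormIdeal.
Variables I Gam : set A.
Hypothesis hI : form_ideal I Gam.

Lemma FU_subgroup : subgroup (FU n I Gam).
Proof. exact: subgroup_gen_subgroup. Qed.

(** Coordinates of v are split off one at a time as short generators; each split changes the
    parameter by some x - lam bar(x) with x in I. *)
Lemma esd_FU h v c : perp h v -> vec_in I v -> Gam c -> FU n I Gam (esd h v c).
Proof.
have [I0 ID IN] := level_subgroup hI; have [_ GM _] := FU_subgroup.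
move=> [v1 v2] Iv Gc; rewrite (col_ebaseE v).
(* The induction runs over partial sums and quantifies over c, since the parameter changes at each
   step. *)
suff: let s := \sum_k vscale (ebase k) (v k ord0) in
  [/\ perp h s, vec_in I s & forall c, Gam c -> FU n I Gam (esd h s c)].
  by case=> _ _; apply.
elim: (index_enum _) => [|k r [hr Ir IHr]] /=.
  rewrite big_nil; split=> [|i|d Gd]; [exact: perp0|by rewrite mxE|].
  by apply: sub_gen_smallest; apply/elementaryP; right; exists h, d.
rewrite big_cons; set s := \sum_(_ <- r) _ in hr Ir IHr *.
(* Zero coordinates are skipped; this disposes of k = h and k = -h, where no short generator
   exists. *)
have [vk0|vk0] := eqVneq (v k ord0) 0; first by rewrite vk0 vscale0 add0r.
have kh : k != h by apply: contra vk0 => /eqP ->; rewrite v1.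
have krh : k != rev_ord h by apply: contra vk0 => /eqP ->; rewrite v2.
have hk := perp_ebase (v k ord0) kh krh.
split=> [||d Gd]; first exact: perpD.
  by apply: vec_inD => //; apply: (vec_in_vscale hI).
set f := form_f s (vscale (ebase k) (v k ord0)).
have -> : esd h (vscale (ebase k) (v k ord0) + s) d
  = (esd h (vscale (ebase k) (v k ord0)) 0 * esd h s (d - (f - lam * bar f)))%g.
  by rewrite esdM // add0r addrNK.
apply: GM; last apply: IHr.
  apply: sub_gen_smallest; apply/elementaryP; left.
  by exists h, k, (v k ord0).
apply: addsubB => //; first exact: (param_subgroup hI).
by apply: (param_skew hI); apply: (form_f_inl hI).
Qed.

Lemma FU_sub_GU_rel : FU n I Gam `<=` GU_rel n I Gam.
Proof.
have [I0 _ _] := level_subgroup hI; have [G0 _ _] := param_subgroup hI.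
apply: smallest_sub; first exact: (GU_rel_subgroup n hI).
move=> g /elementaryP[[h [k [x [kh krh Ix ->]]]]|[h [c [Gc ->]]]].
  apply: (esd_GU_rel hI) => //; first exact: perp_ebase.
  exact: (vec_in_vscale hI).
by apply: (esd_GU_rel hI) => //; [exact: perp0 | move=> i; rewrite mxE].
Qed.

(** The parameter moves by phi_g(v), which [fdefect_GU] places in Gam: the stabiliser normalises the
    level (I, Gam) part of the radical at p. *)
Lemma conj_esd_FU p g v c : levi p g -> perp p v -> vec_in I v -> Gam c ->
  FU n I Gam (g * esd p v c * g^-1)%g.
Proof.
move=> Lg pv Iv Gc; rewrite esd_conj //; apply: esd_FU.
- exact: levi_perp.
- exact: (vec_in_mulmx hI).
- have [_ GD _] := param_subgroup hI; apply: GD => //.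
  exact: (fdefect_GU hI (levi_GU Lg)).
Qed.

End FormIdeal.

Lemma EU_sub_GU : EU n `<=` @GU A n.
Proof.
have hA := form_ideal_setT A.
by move=> g /(FU_sub_GU_rel hA) /(GU_relP hA)[].
Qed.

Lemma EU_rel_sub_GU_rel I Gam : form_ideal I Gam ->
  EU_rel n I Gam `<=` GU_rel n I Gam.
Proof.
move=> hI g; apply; split; last exact: FU_sub_GU_rel.
split; first exact: GU_rel_subgroup.
by move=> x y /EU_sub_GU Ux; apply: GU_rel_conj.
Qed.

Lemma esd_levi h k v c : k != h -> k != rev_ord h -> perp h v -> perp k v ->
  Lam c -> levi k (esd h v c).
Proof.
move=> kh krh hv [kv kv'] Lc.
have stab j : j != h -> j != rev_ord h -> v (rev_ord j) ord0 = 0 ->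
    act (esd h v c) (ebase j) = ebase j.
  move=> jh jrh jv; rewrite act_esd // ebase_neq // form_h_ebaser jv bar0.
  by rewrite !mulr0 subr0 !vscale0 !addr0.
split; first by case: (esd_GU_rel (form_ideal_setT A) hv (fun=> Logic.I) Lc).
  exact: stab.
apply: stab; last by rewrite rev_ordK.
  by apply: contra krh => /eqP <-; rewrite rev_ordK.
by rewrite (inj_eq rev_ord_inj).
Qed.

End ElementaryGenerators.

(** * Commutators of elementary subgroups *)

Section ElementaryCommutators.
Local Open Scope ring_scope.
Variables (A : formRing) (n : nat).
Local Notation V := 'cV[A]_(2 * n).
Local Notation G := (GL A (2 * n)).
Implicit Types (I J Gam Del S : set A) (a b c d x y z : A) (u v w : V) (g t : G).
Implicit Types (h i j k l p q : 'I_(2 * n)).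
Local Notation phi g u := (fdefect g u u).

Lemma conj_comm_mem (H K : set G) g t t' :
  H (g * t * g^-1)%g -> K (g * t' * g^-1)%g ->
  comm_subgroup H K (g * (t * t' * t^-1 * t'^-1) * g^-1)%g.
Proof.
move=> Ht Kt; have := mem_comm_subgroup Ht Kt.
by rewrite !invgM !invgK !mulgA !mulgVK.
Qed.

Lemma rev_ord_eq h k : (rev_ord h == k) = (h == rev_ord k).
Proof. by rewrite -(inj_eq rev_ord_inj) rev_ordK. Qed.

(** As t fixes e_h and e_{-h}, conjugating t' by t only replaces e_k y by t(e_k y) = e_l xy + e_k
    y. *)
Lemma esd_short_comm h k l x y :
    k != h -> k != rev_ord h -> l != h -> l != rev_ord h ->
    l != k -> l != rev_ord k ->
  let t := esd (rev_ord k) (vscale (ebase l) x) 0 : G in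
  let t' := esd h (vscale (ebase k) y) 0 in
  esd h (vscale (ebase l) (x * y)) 0 = (t * t' * t^-1 * t'^-1)%g.
Proof.
move=> kh krh lh lrh lk lrk t t'.
have hk : perp h (vscale (ebase k) y) by exact: perp_ebase.
have hl : perp h (vscale (ebase l) (x * y)) by exact: perp_ebase.
have kl : perp (rev_ord k) (vscale (ebase l) x) by apply: perp_ebase; rewrite ?rev_ordK.
have Lt : levi h t.
  apply: esd_levi => //; rewrite ?rev_ordK.
  - by rewrite eq_sym rev_ord_eq.
  - by rewrite eq_sym.
  - exact: perp_ebase.
  - by have [] := Lam_additive A.
apply: (mulIg t'); rewrite mulgVK esd_conj //.
have krl : k != rev_ord l by rewrite eq_sym rev_ord_eq.
have tk : act t (vscale (ebase k) y) = vscale (ebase l) (x * y) + vscale (ebase k) y.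
  rewrite actZ act_esd_short ?rev_ordK // ebaseE eqxx mulr1.
  by rewrite (ebase_neq A krl) mulr0 vscale0 subr0; apply/colP=> i; rewrite !mxE; ncring.
rewrite tk (esdM _ _ hl hk) /fdefect tk !form_fE (form_f_ebase A krl).
rewrite (form_f_ebase A lrk) !(form_f_ebase A (rev_ord_neq _)).
by rewrite !(mul0r, mulr0, bar0, subr0, addr0).
Qed.

Section Commutators.
Variables I Gam J Del : set A.
Hypotheses (hI : form_ideal I Gam) (hJ : form_ideal J Del).
Let C := comm_subgroup (FU n I Gam) (FU n J Del).

Let Csub : subgroup C := subgroup_gen_subgroup _.

Lemma conj_short_FU I0 Gam0 p g h x : form_ideal I0 Gam0 ->
    levi p g -> h != p -> h != rev_ord p -> I0 x ->
  FU n I0 Gam0 (g * esd p (vscale (ebase h) x) 0 * g^-1)%g.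
Proof.
move=> h0 Lg hp hrp Ix; apply: (conj_esd_FU h0) => //; first exact: perp_ebase.
  exact: (vec_in_vscale h0).
by have [] := param_subgroup h0.
Qed.

Lemma conj_short_FU' I0 Gam0 p g h x : form_ideal I0 Gam0 ->
    levi p g -> p != h -> p != rev_ord h -> I0 x ->
  FU n I0 Gam0 (g * esd h (vscale (ebase p) x) 0 * g^-1)%g.
Proof.
move=> h0 Lg ph prh Ix; rewrite esd_swap //; apply: conj_short_FU => //.
- by rewrite eq_sym.
- by rewrite -rev_ord_eq eq_sym.
have [_ _ IN] := level_subgroup h0.
by apply: IN; apply: (level_mull h0); apply: (level_bar h0).
Qed.

Lemma levi_revE p g : levi p g -> levi (rev_ord p) g.
Proof. by rewrite -{1}[p]rev_ordK; apply: levi_rev. Qed.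

(** Routing through p gives one factor in the radical at -p and, after [esd_swap], the other in the
    radical at p; g normalises both. *)
Lemma conj_short_prod p g h l x y : levi p g ->
    h != p -> h != rev_ord p -> l != p -> l != rev_ord p ->
    l != h -> l != rev_ord h -> I x -> J y ->
  C (g * esd h (vscale (ebase l) (x * y)) 0 * g^-1)%g.
Proof.
move=> Lg hp hrp lp lrp lh lrh Ix Jy.
have ph : p != h by rewrite eq_sym.
have prh : p != rev_ord h by rewrite -rev_ord_eq eq_sym.
rewrite (@esd_short_comm h p l) //; apply: conj_comm_mem.
  by apply: (conj_short_FU hI) => //; rewrite ?rev_ordK //; apply: levi_revE.
exact: (conj_short_FU' hJ).
Qed.

(** Both factors lie in the radical at h, so [esdM] gives their two products, which differ only in
    the parameter. For positive k, f(e_k, e_{-k}) = 1 and f(e_{-k}, e_k) = 0. *)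
Lemma esd_long_comm h k a b : k != h -> k != rev_ord h -> (k < n)%N ->
  let t := esd h (vscale (ebase k) a) 0 : G in
  let t' := esd h (vscale (ebase (rev_ord k)) b) 0 in
  esd h 0 (bar a * b - lam * bar (bar a * b)) = (t' * t * t'^-1 * t^-1)%g.
Proof.
move=> kh krh kn t t'.
have rkh : rev_ord k != h by rewrite rev_ord_eq.
have rkrh : rev_ord k != rev_ord h by rewrite (inj_eq rev_ord_inj).
have pt : perp h (vscale (ebase k) a) by exact: perp_ebase.
have pt' : perp h (vscale (ebase (rev_ord k)) b) by exact: perp_ebase.
apply: (mulIg t); rewrite mulgVK; apply: (mulIg t'); rewrite mulgVK.
have E1 : (t * t')%g = _ := esdM 0 0 pt pt'.
have E2 : (t' * t)%g = _ := esdM 0 0 pt' pt.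
clearbody t t'; rewrite -mulgA {}E1 {}E2.
rewrite (esd_cM _ _ (perpD pt pt')).
rewrite [X in esd h X _]addrC !form_fE !form_f_ebasel !ebaseE rev_ordK !eqxx.
rewrite rev_ord_lt kn /= !(mul0r, mulr0) !bar0; congr (esd _ _ _).
by rewrite !mul1r; ncring.
Qed.

Lemma conj_long_skew p g h x y : levi p g -> h != p -> h != rev_ord p ->
    I x -> J y ->
  C (g * esd h 0 (x * y - lam * bar (x * y)) * g^-1)%g.
Proof.
(* The stabilisers at p and -p coincide, so the sign of p can be chosen. *)
move=> + + + Ix Jy; wlog pn : p / (p < n)%N.
  move=> W Lg hp hrp; have [pn|pn] := boolP (p < n)%N; first exact: (W p).
  apply: (W (rev_ord p)); rewrite ?rev_ord_lt ?rev_ordK //; exact: levi_revE.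
move=> Lg hp hrp; have ph : p != h by rewrite eq_sym.
have prh : p != rev_ord h by rewrite -rev_ord_eq eq_sym.
have rph : rev_ord p != h by rewrite rev_ord_eq.
have rprh : rev_ord p != rev_ord h by rewrite (inj_eq rev_ord_inj).
rewrite -[x]barK (@esd_long_comm h p) //; apply: comm_subgroup_sym.
apply: conj_comm_mem.
  by apply: (conj_short_FU' hJ) => //; apply: levi_revE.
by apply: (conj_short_FU' hI) => //; apply: (level_bar hI).
Qed.

(** The commutator of a long element T at p with a short element X is the wanted long element, up to
    sign, times a short element Y with parameter cz in IJ. Since Y involves p, its conjugates are
    supplied as a hypothesis. *)
Lemma conj_long_sandwich p g h c z : levi p g -> h != p -> h != rev_ord p ->
    (forall k x y, k != h -> k != rev_ord h -> (k == p) || (k == rev_ord p) ->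
       I x -> J y -> C (g * esd h (vscale (ebase k) (x * y)) 0 * g^-1)%g) ->
    Gam c -> J z ->
  C (g * esd h 0 (bar z * c * z) * g^-1)%g.
Proof.
move=> + + + + Gc Jz; wlog pn : p / ~~ (p < n)%N.
  move=> W Lg hp hrp HY; have [pn|pn] := boolP (p < n)%N; last exact: (W p).
  apply: (W (rev_ord p)); rewrite ?rev_ord_lt ?rev_ordK ?negbK //.
    exact: levi_revE.
  by move=> k x y kh krh; rewrite orbC; apply: HY.
move=> Lg hp hrp HY; have ph : p != h by rewrite eq_sym.
have prh : p != rev_ord h by rewrite -rev_ord_eq eq_sym.
have rph : rev_ord p != h by rewrite rev_ord_eq.
have rprh : rev_ord p != rev_ord h by rewrite (inj_eq rev_ord_inj).
have Lc := param_Lam hI Gc.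
pose T : G := esd p 0 c.
pose X : G := esd h (vscale (ebase (rev_ord p)) z) 0.
pose Y : G := esd h (vscale (ebase p) (c * z)) 0.
have pX : perp h (vscale (ebase (rev_ord p)) z) by exact: perp_ebase.
have pY : perp h (vscale (ebase p) (c * z)) by exact: perp_ebase.
have LT : levi h T.
  apply: esd_levi => //; exact: perp0.
have TX : act T (vscale (ebase (rev_ord p)) z)
    = vscale (ebase p) (c * z) + vscale (ebase (rev_ord p)) z.
  rewrite actZ act_esd; last exact: perp0.
  rewrite ebaseE eqxx mulr1 form_h0l mulr0 subr0 form_f0r subr0.
  have -> : cw p = 1 :> A by rewrite /cw /wt rev_ord_lt pn bar1.
  by apply/colP=> i; rewrite !mxE; ncring.
have zcz : lam * bar (bar z * c * z) = - (bar z * c * z).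
  by rewrite Lam_bar // -[X in _ * X]barK; apply: Lam_stable.
(* Conjugation by T gives the parameter bar(z) c z, whereas the product YX carries twice that value
   by [zcz]; hence the minus sign. *)
have E : (T * X * T^-1 = esd h 0 (- (bar z * c * z)) * (Y * X))%g.
  have E2 : (esd h 0 (- (bar z * c * z)) * (Y * X))%g = _ :=
    etrans (congr1 ( *%g _) (esdM 0 0 pY pX)) (esd_cM _ _ (perpD pY pX)).
  apply: etrans (esd_conj 0 LT pX) _; apply: etrans (esym E2); clear E2.
  rewrite /fdefect TX !form_fE !form_f_ebasel !ebaseE rev_ordK !eqxx.
  rewrite rev_ord_lt (negPf pn) [p == _]eq_sym [_ == p]eq_sym /=.
  rewrite (negPf (rev_ord_neq p)) /= ?mulr1n ?mulr0n.
  congr (esd _ _ _); rewrite !(mulr0, mul0r, add0r, addr0, subr0, mul1r, mulr1) mulrA.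
  by rewrite zcz; ncring.
suff : C (g * esd h 0 (- (bar z * c * z)) * g^-1)%g.
  have [_ _ SN] := subgroup_esd_long h (subgroup_conj_preim g Csub).
  by move=> /(SN _); rewrite /= opprK.
have -> : esd h 0 (- (bar z * c * z)) = (T * X * T^-1 * X^-1 * Y^-1)%g.
  by rewrite E !mulgA !mulgK.
have [_ CM CV] := subgroup_conj_preim g Csub.
apply: CM; last first.
  by apply: CV; apply: HY; rewrite ?eqxx //; apply: (param_level hI).
apply: conj_comm_mem.
  by apply: (conj_esd_FU hI) => //; [exact: perp0 | move=> i; rewrite mxE;
    have [] := level_subgroup hI].
by apply: (conj_short_FU' hJ) => //; apply: levi_revE.
Qed.

End Commutators.
End ElementaryCommutators.

(** * Passage from FU of the product level to its normal closure under EU *)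

Section NormalClosure.
Local Open Scope ring_scope.
Variables (A : formRing) (n : nat) (I Gam J Del : set A).
Hypotheses (hn : (3 <= n)%N) (hI : form_ideal I Gam) (hJ : form_ideal J Del).
Local Notation G := (GL A (2 * n)).
Local Notation phi g u := (fdefect g u u).
Implicit Types (c x y z : A) (g t : G) (h i j k l p q : 'I_(2 * n)).
Let K := symm_ideal I J.
Let Om := symm_param I Gam J Del.
Let C : set G := comm_subgroup (FU n I Gam) (FU n J Del).

Let hK : form_ideal K Om := symm_form_ideal hI hJ.

Let Csub : subgroup C := subgroup_gen_subgroup _.

(** The at most four indices h, -h, l, -l cannot exhaust 2n >= 6 coordinates. *)
Lemma exists_off h l : exists p,
  [/\ h != p, h != rev_ord p, l != p & l != rev_ord p].
Proof.
have [p|all4] := pickP (fun p => p \notin [:: h; rev_ord h; l; rev_ord l]).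
  rewrite !inE !negb_or => /and4P[p1 p2 p3 p4].
  by exists p; split; rewrite 1?eq_sym // rev_ord_eq.
have : (2 * n <= 4)%N.
  rewrite -[(2 * n)%N]card_ord.
  apply: leq_trans (card_size [:: h; rev_ord h; l; rev_ord l]).
  by apply/subset_leq_card/fintype.subsetP => p _; rewrite -[_ \in _]negbK all4.
by rewrite leqNgt (@leq_trans (2 * 3)) // leq_mul2l hn.
Qed.

(** For fixed g the admissible x form an additive subgroup, so products in IJ suffice; those in JI
    follow by exchanging the two form ideals. *)
Lemma conj_short_symm p g h l x : levi p g ->
    h != p -> h != rev_ord p -> l != p -> l != rev_ord p ->
    l != h -> l != rev_ord h -> K x ->
  C (g * esd h (vscale (ebase l) x) 0 * g^-1)%g.
Proof.
move=> Lg hp hrp lp lrp lh lrh; move: x; apply: symm_ideal_min.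
- exact: subgroup_esd_short (subgroup_conj_preim g Csub) lh lrh.
- by move=> x y Ix Jy; apply: (conj_short_prod hI hJ Lg).
- move=> x y Ix Jy; apply: comm_subgroup_sym.
  exact: (conj_short_prod hJ hI Lg).
Qed.

Lemma conj_long_symm p g h c : levi p g -> h != p -> h != rev_ord p ->
    (forall k x, k != h -> k != rev_ord h -> (k == p) || (k == rev_ord p) ->
       K x -> C (g * esd h (vscale (ebase k) x) 0 * g^-1)%g) ->
    Om c ->
  C (g * esd h 0 c * g^-1)%g.
Proof.
move=> Lg hp hrp HY; move: c.
have Ssub := subgroup_esd_long h (subgroup_conj_preim g Csub).
apply: (symm_param_min hI hJ Ssub) => [|z c Jz Gc|z c Iz Dc].
- apply: symm_ideal_min.
  + apply: (addsub_preim (f := fun x => x - lam * bar x) _ Ssub) => x y.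
    exact: skewD.
  + by move=> x y Ix Jy; apply: (conj_long_skew hI hJ Lg).
  + move=> x y Ix Jy; apply: comm_subgroup_sym; exact: (conj_long_skew hJ hI Lg).
- rewrite -{1}[z]barK; apply: (conj_long_sandwich hI hJ Lg) => //.
    by move=> k x y kh krh kp Ix Jy; apply: HY => //; apply: symm_ideall.
  exact: (level_bar hJ).
- rewrite -{1}[z]barK; apply: comm_subgroup_sym.
  apply: (conj_long_sandwich hJ hI Lg) => //.
    move=> k x y kh krh kp Jx Iy; apply: comm_subgroup_sym.
    by apply: HY => //; apply: symm_idealr.
  exact: (level_bar hI).
Qed.

Lemma esd_short_symm h l x : l != h -> l != rev_ord h -> K x ->
  C (esd h (vscale (ebase l) x) 0).
Proof.
move=> lh lrh Kx; have [p [hp hrp lp lrp]] := exists_off h l.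
have := conj_short_symm (levi1 A p) hp hrp lp lrp lh lrh Kx.
by rewrite invg1 mul1g mulg1.
Qed.

Lemma FU_symm_sub_comm : FU n K Om `<=` C.
Proof.
apply: smallest_sub Csub _ => t.
case/elementaryP=> [[h [l [x [lh lrh Kx ->]]]]|[h [c [Oc ->]]]].
  exact: esd_short_symm.
have [p [hp hrp _ _]] := exists_off h h.
suff : C (1 * esd h 0 c * 1^-1)%g by rewrite invg1 mul1g mulg1.
apply: (conj_long_symm (levi1 A p)) => // k x kh krh _ Kx.
by rewrite invg1 mul1g mulg1; apply: esd_short_symm.
Qed.

Definition elementary_off p : set G :=
  [set t | (exists h l x, [/\ h != p, h != rev_ord p, l != p & l != rev_ord p]
              /\ [/\ l != h, l != rev_ord h, K x
                   & t = esd h (vscale (ebase l) x) 0])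
        \/ (exists h c, [/\ h != p, h != rev_ord p, Om c & t = esd h 0 c])].

Lemma elementary_off_FU p : elementary_off p `<=` FU n K Om.
Proof.
move=> t et; apply: sub_gen_smallest; apply/elementaryP.
case: et => [[h [l [x [_ [lh lrh Kx ->]]]]]|[h [c [_ _ Oc ->]]]].
  by left; exists h, l, x.
by right; exists h, c.
Qed.

Lemma elementary_off_levi p t : elementary_off p t -> levi p t.
Proof.
have L0 : Lam (0 : A) by have [] := Lam_additive A.
case=> [[h [l [x [[hp hrp lp lrp] [lh lrh Kx ->]]]]]|[h [c [hp hrp Oc ->]]]].
  apply: esd_levi => //; rewrite ?[p == _]eq_sym // ?rev_ord_eq //.
  - exact: perp_ebase.
  - exact: perp_ebase.
apply: esd_levi; rewrite ?[p == _]eq_sym // ?rev_ord_eq //; try exact: perp0.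
exact: (param_Lam hK).
Qed.

(** The index p varies with the generator: each t is conjugated only by stabilisers at an index that
    t avoids. *)
Let Z : set G := subgroup_gen
  [set s | exists p g t, [/\ levi p g, elementary_off p t & s = (g * t * g^-1)%g]].

Let Zsub : subgroup Z := subgroup_gen_subgroup _.

Let mem_Z p g t : levi p g -> elementary_off p t -> Z (g * t * g^-1)%g.
Proof. by move=> Lg et; apply: sub_gen_smallest; exists p, g, t. Qed.

(** In the long case the auxiliary short elements involve p, but [esd_swap] puts them in a radical
    normalised by g, so their conjugates lie in FU of level (K, Om), already inside [C]. *)
Let Z_sub_C : Z `<=` C.
Proof.
apply: smallest_sub Csub _ => _ [p [g [t [Lg et ->]]]].
case: et => [[h [l [x [[hp hrp lp lrp] [lh lrh Kx ->]]]]]|[h [c [hp hrp Oc ->]]]].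
  exact: (conj_short_symm Lg).
apply: (conj_long_symm Lg) => // k x kh krh kp Kx.
have hK0 : Om 0 by have [] := param_subgroup hK.
apply: FU_symm_sub_comm; rewrite esd_swap //.
have pv : perp k (vscale (ebase h : 'cV[A]_(2 * n)) (- (cw h * wt k * bar x))).
  by apply: perp_ebase; rewrite eq_sym ?rev_ord_eq.
apply: (conj_esd_FU hK) => //.
  by case/orP: kp => /eqP ->; last exact: levi_revE.
apply: (vec_in_vscale hK); have [_ _ KN] := level_subgroup hK; apply: KN.
by apply: (level_mull hK); apply: (level_bar hK).
Qed.

Let FU_sub_Z : FU n K Om `<=` Z.
Proof.
apply: smallest_sub Zsub _ => t.
case/elementaryP=> [[h [l [x [lh lrh Kx ->]]]]|[h [c [Oc ->]]]].
  have [p [hp hrp lp lrp]] := exists_off h l.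
  have -> : esd h (vscale (ebase l) x) 0
      = (1 * esd h (vscale (ebase l) x) 0 * 1^-1)%g by rewrite invg1 mul1g mulg1.
  by apply: (mem_Z (levi1 A p)); left; exists h, l, x.
have [p [hp hrp _ _]] := exists_off h h.
have -> : esd h 0 c = (1 * esd h 0 c * 1^-1)%g by rewrite invg1 mul1g mulg1.
by apply: (mem_Z (levi1 A p)); right; exists h, c.
Qed.

(* For g stabilising e_q and e_{-q}, u = g^-1 s g is again an Eichler
   transformation esd q, and [u, t] lies in the part of level (K, Om) of the
   unipotent radical at q, which g normalises. *)
Let conj_esd_Z q v c p g t :
    (q == p) || (q == rev_ord p) -> perp q v -> Lam c ->
    levi p g -> elementary_off p t ->
  let s := esd q v c in Z (s * (g * t * g^-1) * s^-1)%g.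
Proof.
move=> qp qv Lc Lg et s; have Lt := elementary_off_levi et.
have levi_q (r : G) : levi p r -> levi q r.
  by case/orP: qp => /eqP -> //; exact: levi_revE.
have Lgq := levi_q _ Lg; have Ltq := levi_q _ Lt.
have LgV := leviV Lgq; have [_ LD _] := Lam_additive A.
set v' := act g^-1%g v; set c' := c + phi g^-1%g v.
have qv' : perp q v' by exact: levi_perp.
have uE : (g^-1 * s * g)%g = esd q v' c'.
  by rewrite -[X in (_ * X)%g]invgK esd_conj.
have /(GU_relP hK)[tU tK tO] := FU_sub_GU_rel hK (elementary_off_FU et).
set w := act t v' - v'.
have qw : perp q w by apply: perpD (levi_perp Ltq qv') (perpN qv').
(* The parameter d cancels the correction of [esdM] and makes esd q w d equal to [t, u] for u = esd
   q v' c'. As t has level (K, Om), w has entries in K and d lies in Om. *)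
set f := form_f v' w; set d := phi t v' - (f - lam * bar f).
have tE : (t * esd q v' c' * t^-1)%g = (esd q w d * esd q v' c')%g.
  rewrite (esd_conj c' Ltq qv') (esdM _ _ qw qv') subrK.
  by congr (esd _ _ _); rewrite /d -/f; ncring.
have -> : (s * (g * t * g^-1) * s^-1)%g
    = ((g * esd q w d * g^-1)^-1 * (g * t * g^-1))%g.
  have -> : s = (g * esd q v' c' * g^-1)%g by rewrite -uE !mulgA mulgV mul1g mulgK.
  move: tE; set u := esd q v' c'; set r := esd q w d => tE.
  have -> : r = (t * u * t^-1 * u^-1)%g by rewrite tE mulgK.
  by rewrite !invgM !invgK !mulgA !mulgVK.
have [_ ZM ZV] := Zsub; apply: ZM; last exact: mem_Z et.
apply: ZV; apply: FU_sub_Z; apply: (conj_esd_FU hK) => //.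
  exact: tK.
have Osub := param_subgroup hK; apply: addsubB => //.
by apply: (param_skew hK); apply: (form_f_inr hK); exact: tK.
Qed.

(** A generator avoiding p and -p is absorbed into the conjugating stabiliser element; one attached
    to p or -p falls under [conj_esd_Z], and a short one along such a basis vector is first turned
    around by [esd_swap]. *)
Let EU_normalises_Z g t : elementary n [set: A] Lam g -> Z t -> Z (g * t * g^-1)%g.
Proof.
move=> eg; move: t; apply: smallest_sub (subgroup_conj_preim g Zsub) _.
have [L0 _ _] := Lam_additive A.
move=> _ [p [r [t [Lr et ->]]]] /=.
have conj_levi s : levi p s -> Z (s * (r * t * r^-1) * s^-1)%g.
  move=> Ls; have -> : (s * (r * t * r^-1) * s^-1 = (s * r) * t * (s * r)^-1)%g.
    by rewrite invgM !mulgA.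
  by apply: mem_Z et; exact: leviM.
case/elementaryP: eg => [[h [k [x [kh krh _ ->]]]]|[h [c [Lc ->]]]]; last first.
  have [hp|hp] := boolP ((h == p) || (h == rev_ord p)).
    by apply: (conj_esd_Z hp) Lr et => //; exact: perp0.
  move: hp; rewrite negb_or => /andP[hp hrp].
  apply: conj_levi; apply: esd_levi => //; rewrite 1?eq_sym //.
  - by rewrite rev_ord_eq.
  - exact: perp0.
  - exact: perp0.
have hk : h != k by rewrite eq_sym.
have hrk : h != rev_ord k by rewrite -rev_ord_eq eq_sym.
have [hp|hp] := boolP ((h == p) || (h == rev_ord p)).
  by apply: (conj_esd_Z hp) Lr et => //; exact: perp_ebase.
have [kp|kp] := boolP ((k == p) || (k == rev_ord p)).
  by rewrite esd_swap //; apply: (conj_esd_Z kp) Lr et => //; exact: perp_ebase.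
move: hp kp; rewrite !negb_or => /andP[hp hrp] /andP[kp krp].
apply: conj_levi; apply: esd_levi => //; rewrite 1?eq_sym ?rev_ord_eq //.
- exact: perp_ebase.
- exact: perp_ebase.
Qed.

Lemma EU_rel_symm_sub_comm :
  EU_rel n K Om `<=` comm_subgroup (FU n I Gam) (FU n J Del).
Proof.
apply: subset_trans Z_sub_C; apply: normal_closure_gen_min => //.
  by move=> g; apply: elementaryV => //; exact: Lam_additive.
Qed.

End NormalClosure.

Theorem mainTheorem3 (A : formRing) (n : nat) (I Gam J Del : set A)
    (hn : (3 <= n)%N) (hI : form_ideal I Gam) (hJ : form_ideal J Del) :
  [/\ EU_rel n (symm_ideal I J) (symm_param I Gam J Del)
        `<=` comm_subgroup (FU n I Gam) (FU n J Del),
      comm_subgroup (FU n I Gam) (FU n J Del)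
        `<=` comm_subgroup (EU_rel n I Gam) (EU_rel n J Del),
      comm_subgroup (EU_rel n I Gam) (EU_rel n J Del)
        `<=` comm_subgroup (GU_rel n I Gam) (GU_rel n J Del)
    & comm_subgroup (GU_rel n I Gam) (GU_rel n J Del)
        `<=` GU_rel n (symm_ideal I J) (symm_param I Gam J Del)].
Proof.
split.
- exact: EU_rel_symm_sub_comm.
- by apply: comm_subgroup_mono; exact: normal_closure_sub.
- by apply: comm_subgroup_mono; exact: EU_rel_sub_GU_rel.
- exact: comm_GU_rel.
Qed.
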